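(* In the setting described in the context, suppose that the following three assumptions hold. (A1) There is a constant $G>0$ such that for all $i\in\mathbb{N}$ and every $\mathcal{F}_{(i\wedge n)-1}$-measurable $\Theta$-valued random variable $\vartheta_i$, $\mathbf{E}[\|\mathsf{G}(\vartheta_i;\xi_i)\|_*^2]\le G^2$. (A2) There is a constant $K_n>0$ such that for all $i=1,\dots,n$ and every $\mathcal{F}_{i-1}$-measurable $\Theta$-valued random variable $\vartheta_i$, $\mathbf{E}[\|\mathsf{K}_{i,n}(\vartheta_i)\|_*^2]\le K_n^2$. (A3) For every $\epsilon>0$, $$\tau_{\mathbf{E}}(\epsilon):=\inf\Big\{\tau\in\mathbb{N}:\ \sup_{i\in\mathbb{N}_0}\mathbf{E}\big[d_{\mathrm{Hel}}^2(P_{[i]|\mathbf{F}}^{i+\tau},\Pi)\big]\le\epsilon^2\Big\}<\infty .$$ Then for any $\epsilon>0$ and any (non-random) $\theta'\in\Theta$, $$\begin{aligned}\mathbf{E}\Big[\sum_{i=1}^{n}(f(\theta_i)-f(\theta'))\Big]&\le 2\sqrt{2}\,GRn\epsilon+\sqrt{2}\,(\tau_{\mathbf{E}}(\epsilon)-1)K_n^2\sum_{i=1}^{n}\eta_i+\frac{R^2}{2\eta_n}+\frac{K_n^2}{2}\sum_{i=1}^{n}\eta_i\\&\quad+(\tau_{\mathbf{E}}(\epsilon)-1)GR+\mathbf{E}\big[\mathcal{R}_{\tau_{\mathbf{E}}(\epsilon)-1,n}(\{\theta_i\})-\mathcal{R}_{\tau_{\mathbf{E}}(\epsilon)-1,n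}(\theta')\big].\end{aligned}$$
   Context: $\mathbb{N}=\{1,2,\dots\}$, $\mathbb{N}_0=\mathbb{N}\cup\{0\}$; $n\in\mathbb{N}$ is fixed. $(\Omega,\mathcal{A},P)$ is a probability space with expectation $\mathbf{E}$. $\Xi\in\mathcal{B}(\mathbb{R}^d)$ with its Borel $\sigma$-field is the state space of an ergodic process $\{\xi_i;i\in\mathbb{N}\}$ with invariant probability measure $\Pi$ on $\Xi$. $\Theta\subset\mathbb{R}^p$ is a compact convex set, $\|\cdot\|$ a norm on $\mathbb{R}^p$ with dual norm $\|\cdot\|_*$, and $N_\Theta$ an open neighbourhood of $\Theta$. The symbol $\partial$ denotes the subdifferential with respect to $\theta$. Losses: $\{F(\cdot;\xi);\xi\in\Xi\}$ is a family of real-valued convex functions on $N_\Theta$; $f(\theta):=\int_\Xi F(\theta;\xi)\,\Pi(d\xi)$ is assumed finite for all $\theta\in N_\Theta$. $\mathsf{G}(\theta;\xi)$ is a jointly measurable function with $\mathsf{G}(\theta;\xi)\in\partial F(\theta;\xi)$ for all $\theta\in\Theta,\xi\in\Xi$. Approximate losses: $H_{1,n},\dots,H_{n,n}$ are real-valued random convex functions on $N_\Theta$, and $\mathsf{K}_{i,n}(\theta)$ are jointly ($\mathcal{A}\otimes\mathcal{B}(N_\Theta)$-)measurable random functions such that almost surely $\mathsf{K}_{i,n}(\theta)\in\partial H_{i,n}(\theta)$ for all $\theta\in\Theta$. Prox-function: $\psi$ is differentiable and $1$-strongly convex on $N_\Theta$ with respect to $\|\cdot\|$; $D_\psi(\theta,\theta'):=\psi(\theta)-\psi(\theta')-\langle\nabla\psi(\theta'),\theta-\theta'\rangle$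 is its Bregman divergence; $R>0$ satisfies $\sup_{\theta_1,\theta_2\in\Theta}D_\psi(\theta_1,\theta_2)\le R^2/2$. Stochastic mirror descent (SMD) update: $\theta_1\in\Theta$ is arbitrary, and for $i=1,\dots,n$ $$\theta_{i+1}=\operatorname*{argmin}_{\theta\in\Theta}\Big\{\langle\mathsf{K}_{i,n}(\theta_i),\theta\rangle+\frac{1}{\eta_i}D_\psi(\theta,\theta_i)\Big\},$$ where $\{\eta_i\}$ is a non-increasing sequence of positive numbers. Filtration: $\mathbf{F}=\{\mathcal{F}_i;i\in\mathbb{N}_0\}$ is a filtration such that $\sigma(\xi_j;j\le i)\subset\mathcal{F}_i$ for all $i\in\mathbb{N}_0$ and $\sigma(\theta_j;j\le i+1)\subset\mathcal{F}_i$ for all $i=0,\dots,n$. For $j>i$, $P_{[i]|\mathbf{F}}^{j}$ denotes the conditional distribution of $\xi_j$ given $\mathcal{F}_i$. Hellinger distance: $d_{\mathrm{Hel}}(P,Q):=\big(\int(\sqrt{dP/d\mu}-\sqrt{dQ/d\mu})^2d\mu\big)^{1/2}$ for any $\mu$ dominating $P$ and $Q$. Residuals: for $\tau\in\mathbb{N}_0$ and a sequence $\{\vartheta_i\}$ of $\Theta$-valued random variables, $\mathcal{R}_{\tau,n}(\{\vartheta_i\}):=\sum_{i=1}^{n-\tau}\big(F(\vartheta_i;\xi_{i+\tau})-H_{i+\tau,n}(\vartheta_i)\big)$ (an empty sum being $0$), and $\mathcal{R}_{\tau,n}(\theta')$ is the value at the constant sequence $\vartheta_i=\theta'$. *)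

(* Defs.v *)
From HB Require Import structures.
From mathcomp Require Export all_boot all_order all_algebra.
From mathcomp Require Export all_classical all_reals all_analysis.
From mathcomp Require Export measurable_realfun.
Export Order.TTheory GRing.Theory Num.Theory.
Export numFieldNormedType.Exports.

Set Implicit Arguments.
Unset Strict Implicit.
Unset Printing Implicit Defensive.

Local Open Scope classical_set_scope.
Local Open Scope convex_scope.
Local Open Scope ring_scope.

(* R^k as a measurable space; convertible to 'rV[R]_k. *)
Notation borel R k := (g_sigma_algebraType (@open 'rV[R]_k)).

Section finite_dimensional_space.
Context {R : realType} {p : nat}.
Implicit Types (nrm : 'rV[R]_p -> R) (D : set 'rV[R]_p) (f : 'rV[R]_p -> R).

Definition inner (x y : 'rV[R]_p) : R := \sum_(i < p) x 0 i * y 0 i.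

(* Nonnegativity and [nrm 0 = 0] follow from these three axioms. *)
Definition is_norm nrm : Prop :=
  [/\ forall x y, nrm (x + y) <= nrm x + nrm y,
      forall (a : R) x, nrm (a *: x) = `|a| * nrm x &
      forall x, nrm x = 0 -> x = 0].

Definition dual_norm nrm (y : 'rV[R]_p) : R :=
  sup [set inner y x | x in [set x | nrm x <= 1]].

Definition subdifferential D f (x : 'rV[R]_p) : set 'rV[R]_p :=
  [set g | forall y, D y -> f x + inner g (y - x) <= f y].

Definition strongly_convex_function (mu : R) nrm
    (D : set (convex_lmodType 'rV[R]_p)) (f : convex_lmodType 'rV[R]_p -> R^o) :=
  forall t : {i01 R}, {in D &, forall x y : convex_lmodType 'rV[R]_p,
    f (x <| t |> y) <=
      f x <| t |> f y - mu / 2 * (t%:num * (1 - t%:num)) * nrm (x - y) ^+ 2}.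

Definition gradient f (x : 'rV[R]_p) : 'rV[R]_p :=
  \row_(i < p) 'D_(delta_mx 0 i) (f : 'rV[R]_p -> R^o) x.

Definition bregman f (x y : 'rV[R]_p) : R :=
  f x - f y - inner (gradient f y) (x - y).

Definition is_argmin D f (x : 'rV[R]_p) : Prop :=
  D x /\ forall y, D y -> f x <= f y.

End finite_dimensional_space.

Section sigma_algebras.
Context {d : measure_display} {T : measurableType d}.

Definition sub_sigma_algebra_of (GG : set (set T)) : Prop :=
  sigma_algebra setT GG /\ GG `<=` measurable.

Definition is_filtration (FF : nat -> set (set T)) : Prop :=
  (forall i, sub_sigma_algebra_of (FF i)) /\
  (forall i j, (i <= j)%N -> FF i `<=` FF j).

Definition sigma_generated {R : realType} {k : nat} (J : set nat)
    (X : nat -> T -> 'rV[R]_k) : set (set T) :=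
  <<s \bigcup_(j in J) preimage_set_system setT (X j : T -> borel R k) measurable >>.

Definition sub_measurable {R : realType} {k : nat} (GG : set (set T))
    (X : T -> 'rV[R]_k) : Prop :=
  preimage_set_system setT (X : T -> borel R k) measurable `<=` GG.

End sigma_algebras.

Section hellinger.
Context {d : measure_display} {T : measurableType d} {R : realType}.

Section sum_measure.
Variables P Q : probability T R.

Definition sum_measure : set T -> \bar R := measure_add P Q.

HB.instance Definition _ := Measure.on sum_measure.

Let sum_measure_fin : fin_num_fun sum_measure.
Proof.
move=> A mA; rewrite /sum_measure measure_addE.
by rewrite fin_numD !fin_num_measure.
Qed.

HB.instance Definition _ :=
  @Measure_isFinite.Build _ _ _ sum_measure sum_measure_fin.

End sum_measure.

Definition density (mu : {sigma_finite_measure set T -> \bar R})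
    (P : probability T R) (x : T) : R :=
  fine (Radon_Nikodym (charge_of_finite_measure P) mu x).

Definition hellinger_wrt (mu : {sigma_finite_measure set T -> \bar R})
    (P Q : probability T R) : R :=
  Num.sqrt (\int[mu]_x (Num.sqrt (density mu P x) - Num.sqrt (density mu Q x)) ^+ 2).

(* The value does not depend on the dominating measure; [P + Q] is one. *)
Definition hellinger (P Q : probability T R) : R :=
  hellinger_wrt (sum_measure P Q) P Q.

End hellinger.

Section processes.
Context {dO : measure_display} {Omega : measurableType dO} {R : realType}.
Context (P : probability Omega R) {d : nat}.
Implicit Types (xi : nat -> Omega -> 'rV[R]_d) (Pi : probability (borel R d) R).

(* Mean ergodicity: time averages of bounded observables converge in L^1 to
   their space averages. The process is indexed from 1. *)
Definition ergodic_process (Xi : set (borel R d)) xi Pi : Prop :=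
  forall h : borel R d -> R, measurable_fun Xi h ->
    (exists M : R, forall x, Xi x -> `|h x| <= M) ->
    (fun m : nat => ('E_P[fun w =>
        `|m.+1%:R^-1 * \sum_(1 <= i < m.+2) h (xi i w)
          - \int[Pi]_(x in Xi) h x|%R])%E)
      @ \oo --> 0%E.

(* [kap] is a version of the regular conditional distribution of [X] given [GG];
   any two versions agree almost surely. *)
Definition is_cond_distribution (GG : set (set Omega)) (X : Omega -> 'rV[R]_d)
    (kap : Omega -> probability (borel R d) R) : Prop :=
  forall B : set (borel R d), measurable B ->
    measurable_fun setT
      (fun w : g_sigma_algebraType GG => kap w B) /\
    forall A : set Omega, GG A ->
      P (A `&` X @^-1` B) = (\int[P]_(w in A) kap w B)%E.

(* [kap i j] is the conditional distribution of the [j]-th state given the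
   past up to time [i]. *)
Definition mixing_set Pi (kap : nat -> nat -> Omega -> probability (borel R d) R)
    (eps : R) : set nat :=
  [set tau | (0 < tau)%N /\
    (ereal_sup [set 'E_P[fun w => (hellinger (kap i (i + tau)%N w) Pi ^+ 2)%R] | i in setT]
       <= (eps ^+ 2)%:E)%E].

(* Equal to [+oo] when no such lag exists. *)
Definition mixing_time Pi kap (eps : R) : \bar R :=
  ereal_inf [set (tau%:R)%:E | tau in mixing_set Pi kap eps].

Definition mixing_lag Pi kap (eps : R) : nat :=
  Num.truncn (fine (mixing_time Pi kap eps)).

End processes.

(* [n - tau] is truncated, so the sum is empty when [n <= tau]. *)
Definition residual {Omega : Type} {R : realType} {d p : nat}
    (F : 'rV[R]_p -> 'rV[R]_d -> R) (H : nat -> Omega -> 'rV[R]_p -> R)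
    (xi : nat -> Omega -> 'rV[R]_d) (tau n : nat)
    (vt : nat -> Omega -> 'rV[R]_p) (w : Omega) : R :=
  \sum_(1 <= i < (n - tau).+1)
    (F (vt i w) (xi (i + tau)%N w) - H (i + tau)%N w (vt i w)).

(* Main.v *)
From HB Require Import structures.
Require Import Defs.
From mathcomp Require Import ring lra zify.

Set Implicit Arguments.
Unset Strict Implicit.
Unset Printing Implicit Defensive.

Local Open Scope classical_set_scope.
Local Open Scope ring_scope.

(** Let [m := tau - 1]. For [i <= n - m] the excess [f theta_i - f theta'] is
    the sum of three differences between [theta_i] and [theta']: that of
    [f - F (.; xi_(i+m))], that of [F (.; xi_(i+m)) - H_(i+m)], and that of
    [H_(i+m)]. The second ones add up to the residual term, and the at most [m]
    remaining indices cost [G R] each.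

    Mixing. The iterate [theta_i] is determined by the past up to time [i - 1],
    and [xi_(i+m)] is observed [tau] steps after that time, so that its
    conditional law is close to [Pi]. If [p] and [q] are the densities of two
    laws and [g] is a function, then
      [g (q - p) <= lam g^2 (p + q) + (sqrt p - sqrt q)^2 / (2 lam)],
    which bounds the difference of the means of [g] by second moments and the
    squared Hellinger distance ([hellinger_transport], [mixing_gap]). With
    [g := F (theta_i; .) - F (theta'; .)] both second moments are at most
    [2 R^2 G^2], and the best [lam] gives [2 sqrt 2 G R eps]. The moment
    assumption (A1) speaks of sampled states only; its analogue for the
    invariant law follows by applying the same comparison to truncations at
    larger and larger lags ([stationary_le]).

    Optimisation. Mirror descent moves by at most [eta_j ||K_j||] in step [j],
    so that replacing [theta_i] by [theta_(i+m)] in [H_(i+m)] costs a product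
    of two dual norms for each of the [m] steps in between. What is left is the
    usual regret of mirror descent, which telescopes up to the monotone
    weights [1 / eta_i] ([delayed_regret_le]).

    Measurability. A difference [F (t; x) - F (t'; x)] is the limit of Riemann
    sums of subgradients along the segment from [t'] to [t]
    ([subgradient_riemann_cvg]), and hence inherits the joint measurability of
    the chosen subgradients; the same holds for [H] outside a null set. The
    Hellinger distance may fail to be a measurable function of the sample
    point, but its integral still bounds that of every measurable function
    below it ([le_integralD_nonmeasurable]). *)

(** Real comparisons are cleared first: the solver would otherwise make lemmas
    about indices depend on them. *)
Ltac nat_lia :=
  repeat match goal with H : is_true (Order.lt _ _) |- _ => clear H end; lia.

(** * Integrals of functions that may fail to be measurable *)

Section lower_integral.
Context {d : measure_display} {T : measurableType d} {R : realType}.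
Context (mu : {measure set T -> \bar R}).
Local Open Scope ereal_scope.

(** The integral of a nonnegative function is a supremum over the simple
    functions below it, hence monotone without any measurability. *)
Lemma le_integral_nonmeasurable (f g : T -> \bar R) :
  (forall x, 0 <= f x) -> (forall x, f x <= g x) ->
  \int[mu]_x f x <= \int[mu]_x g x.
Proof.
move=> f0 fg; have g0 x : 0 <= g x by exact: le_trans (fg x).
have pE (h : T -> \bar R) : (forall x, 0 <= h x) -> (h \_ setT)^\+ = h.
  by move=> h0; rewrite patch_setT; apply/funext => x; rewrite funeposE max_l.
have nE (h : T -> \bar R) : (forall x, 0 <= h x) -> (h \_ setT)^\- = cst 0.
  by move=> h0; rewrite patch_setT; apply/funext => x; rewrite funenegE max_r// leeNl oppe0.
rewrite /integral !pE// !nE//; apply: leeB => //.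
by apply: ereal_sup_le => _ [h hf <-]; exists h => // x; exact: le_trans (hf x) (fg x).
Qed.

(** A null set [N] outside which [f = g] squeezes [f] between the restriction of
    [g] to the complement of [N] and the function that replaces [g] by [+oo] on
    [N]; both are measurable and have the integral of [g]. *)
Lemma ge0_ae_eq_integral_nonmeasurable (f g : T -> \bar R) :
  (forall x, 0 <= f x) -> (forall x, 0 <= g x) -> measurable_fun setT g ->
  {ae mu, forall x, f x = g x} -> \int[mu]_x f x = \int[mu]_x g x.
Proof.
move=> f0 g0 mg [N [mN N0 fgN]].
have fgE x : ~ N x -> f x = g x.
  by move=> Nx; apply: contrapT => fgx; apply: Nx; exact: fgN.
apply/eqP; rewrite eq_le; apply/andP; split; last first.
  rewrite (ge0_negligible_integral mN measurableT mg (fun x _ => g0 x) N0).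
  rewrite integral_mkcond.
  apply: le_integral_nonmeasurable => x; first by rewrite patchE; case: ifPn.
  by rewrite patchE; case: ifPn => //; rewrite inE => -[_ /fgE ->].
pose g' := fun x => if x \in N then +oo else g x.
have mg' : measurable_fun setT g'.
  apply: measurable_fun_ifT => //.
  apply: (@measurable_fun_bool _ _ _ _ true); rewrite setTI.
  by rewrite [X in measurable X](_ : _ = N)//; apply/seteqP; split => x /=; [move/set_mem|move/mem_set].
have g'0 x : 0 <= g' x by rewrite /g'; case: ifPn.
rewrite (@le_trans _ _ (\int[mu]_x g' x))//.
  apply: le_integral_nonmeasurable => // x; rewrite /g'; case: ifPn.
    by rewrite leey.
  by rewrite notin_setE => /fgE ->.
rewrite (ge0_negligible_integral mN measurableT mg' (fun x _ => g'0 x) N0).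
rewrite (ge0_negligible_integral mN measurableT mg (fun x _ => g0 x) N0).
rewrite le_eqVlt; apply/orP; left; apply/eqP; apply: eq_integral => x.
by rewrite inE /g' => -[_ Nx]; rewrite ifN// notin_setE.
Qed.

Lemma ae_eq_integral_nonmeasurable (f g : T -> \bar R) :
  measurable_fun setT g ->
  {ae mu, forall x, f x = g x} -> \int[mu]_x f x = \int[mu]_x g x.
Proof.
move=> mg fg; rewrite integralE [in RHS]integralE; congr (_ - _);
  apply: ge0_ae_eq_integral_nonmeasurable => //.
- exact: measurable_funepos.
- by apply: filterS fg => x; rewrite !funeposE => ->.
- exact: measurable_funeneg.
- by apply: filterS fg => x; rewrite !funenegE => ->.
Qed.

(** Only [h] may fail to be measurable: it dominates the measurable function
    [max (f - g) 0 / c], whose integral is therefore at most that of [h]. *)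
Lemma le_integralD_nonmeasurable (f g : T -> \bar R) (h : T -> R) (c : R) :
  (forall x, 0 <= f x) -> (forall x, 0 <= g x) -> (forall x, 0 <= h x)%R ->
  (0 < c)%R -> measurable_fun setT f -> measurable_fun setT g ->
  (forall x, f x <= g x + (c * h x)%:E) ->
  \int[mu]_x f x <= \int[mu]_x g x + c%:E * \int[mu]_x (h x)%:E.
Proof.
move=> f0 g0 h0 c0 mf mg fgh.
pose e x := maxe (f x - g x) 0.
have me : measurable_fun setT e.
  by apply: measurable_maxe => //; exact: emeasurable_funB.
have e0 x : 0 <= e x by rewrite le_max lexx orbT.
have eh x : c^-1%:E * e x <= (h x)%:E.
  rewrite lee_pdivrMl// -EFinM ge_max lee_fin mulr_ge0 ?(ltW c0)// andbT.
  have := fgh x; have := g0 x; have := f0 x.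
  case: (g x) => [r||]//; case: (f x) => [s||]//=; rewrite ?leNye//.
  by rewrite !lee_fin => _ _; rewrite lerBlDl.
apply: (@le_trans _ _ (\int[mu]_x (g x + e x))).
  apply: ge0_le_integral => //.
    exact: emeasurable_funD.
  move=> x _; rewrite /e; have := g0 x; have := f0 x.
  case: (g x) => [r||]//; last first.
    by move=> _ _; rewrite addye ?leey// -ltNye lt_max ltNy0 orbT.
  case: (f x) => [s||]//= _ _; have [sr|sr] := leP (s - r)%:E 0.
    by rewrite adde0; rewrite lee_fin subr_le0 in sr.
  by rewrite -EFinD addrC subrK.
rewrite ge0_integralD//; apply: leeD => //.
rewrite -lee_pdivrMl// -ge0_integralZl_EFin//; last by rewrite invr_ge0 ltW.
apply: le_integral_nonmeasurable => // x.
by rewrite mule_ge0// lee_fin invr_ge0 ltW.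
Qed.

End lower_integral.

(** * Disintegration along a conditional law *)

Section disintegration.
Context {d1 d2 dO : measure_display} {T1 : measurableType d1}
  {T2 : measurableType d2} {Omega : measurableType dO} {R : realType}.
Context (P : probability Omega R) (kap : Omega -> probability T2 R).
Context (X : Omega -> T1) (Y : Omega -> T2).
Hypothesis mkap : forall B, measurable B -> measurable_fun setT (fun w => kap w B).
Hypothesis mX : measurable_fun setT X.
Hypothesis mY : measurable_fun setT Y.
Hypothesis XY_rectangle : forall A B, measurable A -> measurable B ->
  P (X @^-1` A `&` Y @^-1` B) = (\int[P]_(w in X @^-1` A) kap w B)%E.
Local Open Scope ereal_scope.

Definition cond_kernel (_ : forall B, measurable B ->
    measurable_fun setT (fun w => kap w B)) : Omega -> {measure set T2 -> \bar R} :=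
  kap.

HB.instance Definition _ := @isKernel.Build _ _ Omega T2 R (cond_kernel mkap) mkap.

Let cond_kernel_setT w : cond_kernel mkap w setT = 1.
Proof. exact: probability_setT. Qed.

HB.instance Definition _ :=
  @Kernel_isProbability.Build _ _ Omega T2 R (cond_kernel mkap) cond_kernel_setT.

Let mXid (phi : T1 * T2 -> \bar R) : measurable_fun setT phi ->
  measurable_fun [set: Omega * T2] (fun z => phi (X z.1, z.2)).
Proof.
move=> mphi; apply: measurableT_comp => //.
exact: measurable_fun_pair (measurableT_comp mX measurable_fst) measurable_snd.
Qed.

Lemma measurable_cond_integral (phi : T1 * T2 -> \bar R) :
  (forall z, 0 <= phi z) -> measurable_fun setT phi ->
  measurable_fun setT (fun w => \int[kap w]_x phi (X w, x)).
Proof.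
move=> phi0 mphi.
by apply: (@measurable_fun_integral_finite_kernel _ _ _ _ _ _ (cond_kernel mkap) _ (mXid mphi)).
Qed.


Let mpairX w : measurable_fun [set: T2] (pair (X w) : T2 -> T1 * T2).
Proof. exact: pair1_measurable. Qed.

(** The law of [(X w, y)] when [y] is drawn from [kap w]; the dummy factor
    [unit] gives it the shape of the second factor of a composition of
    kernels. *)
Definition slice_kernel (_ : forall B, measurable B ->
    measurable_fun setT (fun w => kap w B)) (z : unit * Omega) : {measure set (T1 * T2) -> \bar R} :=
  measure_function_pushforward__canonical__measure_function_Measure (kap z.2) (mpairX z.2).

Let mslice U : measurable U ->
  measurable_fun setT (fun z => slice_kernel mkap z U).
Proof.
move=> mU; rewrite /slice_kernel.
pose A : set (Omega * T2) := [set z | U (X z.1, z.2)].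
have mA : measurable A.
  rewrite -[A]setTI.
  have : measurable_fun [set: Omega * T2] (fun z => (X z.1, z.2)).
    exact: measurable_fun_pair (measurableT_comp mX measurable_fst) measurable_snd.
  exact.
have mkA := @measurable_fun_xsection_finite_kernel _ _ _ _ _ (cond_kernel mkap) A (mem_set mA).
have := measurableT_comp mkA (@measurable_snd _ _ unit Omega).
apply: eq_measurable_fun => -[u w] _ /=; rewrite /cond_kernel /pushforward.
by congr (kap w _); apply/seteqP; split => x /=; rewrite /xsection/= inE.
Qed.

HB.instance Definition _ := @isKernel.Build _ _ _ _ R (slice_kernel mkap) mslice.

Let slice_kernel_setT z : slice_kernel mkap z setT = 1.
Proof. exact: probability_setT. Qed.

HB.instance Definition _ :=
  @Kernel_isProbability.Build _ _ _ _ R (slice_kernel mkap) slice_kernel_setT.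

(** Both sides integrate [phi] over [T1 * T2]: the left one against the law of
    [(X, Y)], the right one against the mixture of the slices. These two
    measures agree on rectangles by hypothesis, hence everywhere. *)
Lemma disintegration (phi : T1 * T2 -> \bar R) :
  (forall z, 0 <= phi z) -> measurable_fun setT phi ->
  \int[P]_w phi (X w, Y w) = \int[P]_w \int[kap w]_x phi (X w, x).
Proof.
move=> phi0 mphi.
have mXY : measurable_fun setT (fun w => (X w, Y w)).
  exact: measurable_fun_pair.
pose l : R.-sfker unit ~> Omega :=
  kprobability (measurable_cst (P : pprobability Omega R)).
pose k : R.-sfker (unit * Omega)%type ~> (T1 * T2)%type := slice_kernel mkap.
transitivity (\int[mkcomp l k tt]_z phi z); last first.
  rewrite integral_kcomp//; apply: eq_integral => w _ /=.
  by rewrite ge0_integral_pushforward.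
rewrite -[LHS]/(\int[P]_(w in (fun w => (X w, Y w)) @^-1` setT) (phi \o (fun w => (X w, Y w))) w).
rewrite -(ge0_integral_pushforward mXY)//.
apply: eq_measure_integral => A mA _.
apply: (measure_unique [set A `*` B | A in measurable & B in measurable] (fun=> setT)) => //.
- exact: measurable_prod_measurableType.
- move=> _ _ [A1 mA1 [B1 mB1 <-]] [A2 mA2 [B2 mB2 <-]].
  exists (A1 `&` A2); first exact: measurableI.
  by exists (B1 `&` B2); [exact: measurableI|rewrite setXI].
- by move=> _; exists setT => //; exists setT => //; rewrite setXTT.
- by rewrite bigcup_const.
- move=> _ [A1 mA1 [B1 mB1 <-]].
  transitivity (P (X @^-1` A1 `&` Y @^-1` B1)); first by [].
  rewrite XY_rectangle//= /kcomp/= [LHS]integral_mkcond.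
  apply: eq_integral => w _; rewrite patchE /slice_kernel/= /pushforward.
  case: ifPn => [/set_mem|/negP] Xw.
    by congr (kap w _); apply/seteqP; split => x //= [].
  rewrite (_ : _ @^-1` _ = set0) ?measure0//; apply/seteqP; split => x //= -[A1x _].
  by apply: Xw; exact/mem_set.
- by move=> _; rewrite /= /pushforward preimage_setT probability_setT ltry.
Qed.

End disintegration.

(** * Hellinger distance and change of measure *)

(** With [p = a^2] and [q = b^2] the difference of the two sides is
    [((a - b) + lam (u - v) (a + b))^2 / (2 lam) + lam (u - v)^2 (a - b)^2 / 2]. *)
Lemma hellinger_pointwise {R : realType} (u v p q lam : R) :
  0 <= p -> 0 <= q -> 0 < lam ->
  u * q + v * p <= u * p + v * q + lam * ((u - v) ^+ 2 * p + (u - v) ^+ 2 * q)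
    + (2 * lam)^-1 * (Num.sqrt p - Num.sqrt q) ^+ 2.
Proof.
move=> p0 q0 lam0.
have := sqrtr_ge0 p; have := sqr_sqrtr p0; move: (Num.sqrt p) => a <- a0.
have := sqrtr_ge0 q; have := sqr_sqrtr q0; move: (Num.sqrt q) => b <- b0.
have : 0 <= (2 * lam)^-1 * ((a - b) + lam * (u - v) * (a + b)) ^+ 2.
  by rewrite mulr_ge0 ?sqr_ge0// invr_ge0 mulr_ge0// ltW.
have : 0 <= lam / 2 * (u - v) ^+ 2 * (a - b) ^+ 2.
  by rewrite mulr_ge0 ?sqr_ge0// mulr_ge0 ?sqr_ge0// divr_ge0// ltW.
suff -> : u * a ^+ 2 + v * b ^+ 2 + lam * ((u - v) ^+ 2 * a ^+ 2 + (u - v) ^+ 2 * b ^+ 2) +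
   (2 * lam)^-1 * (a - b) ^+ 2 = u * b ^+ 2 + v * a ^+ 2 + 
  ((2 * lam)^-1 * ((a - b) + lam * (u - v) * (a + b)) ^+ 2 + 
    lam / 2 * (u - v) ^+ 2 * (a - b) ^+ 2) by lra.
by field; rewrite gt_eqF.
Qed.

(** Integration of the preceding inequality, for the positive and negative parts
    of [g], against the sum of the two laws. Keeping the four integrals of these
    parts apart makes every term nonnegative, so that nothing has to be
    integrable. *)
Lemma hellinger_transport {d} {T : measurableType d} {R : realType}
    (k Q : probability T R) (g : T -> R) (lam : R) :
  measurable_fun setT g -> 0 < lam ->
  (\int[Q]_x (g^\+ x)%:E + \int[k]_x (g^\- x)%:E <=
   \int[k]_x (g^\+ x)%:E + \int[Q]_x (g^\- x)%:E
   + lam%:E * (\int[k]_x (g x ^+ 2)%:E + \int[Q]_x (g x ^+ 2)%:E)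
   + (hellinger k Q ^+ 2 / (2 * lam))%:E)%E.
Proof.
move=> mg lam0.
pose mu : {sigma_finite_measure set T -> \bar R} := sum_measure k Q.
have muE A : mu A = (k A + Q A)%E by exact: measure_addE.
have kmu : k `<< mu.
  apply/null_content_dominatesP => A mA muA0.
  have /eqP : (k A + Q A = 0)%E by rewrite -muE.
  by rewrite padde_eq0// => /andP[/eqP].
have Qmu : Q `<< mu.
  apply/null_content_dominatesP => A mA muA0.
  have /eqP : (k A + Q A = 0)%E by rewrite -muE.
  by rewrite padde_eq0// => /andP[_ /eqP].
pose den (P : probability T R) x := fine (Radon_Nikodym_SigmaFinite.f P mu x).
have den0 (P : probability T R) x : P `<< mu -> 0 <= den P x.
  by move=> Pmu; rewrite fine_ge0// Radon_Nikodym_SigmaFinite.f_ge0.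
have mden (P : probability T R) : P `<< mu -> measurable_fun setT (den P).
  move=> Pmu; apply: (measurableT_comp (fine_measurable measurableT)).
  exact: measurable_int (Radon_Nikodym_SigmaFinite.f_integrable Pmu).
have denE (P : probability T R) (phi : T -> R) : P `<< mu ->
    measurable_fun setT phi -> (forall x, 0 <= phi x) ->
    (\int[P]_x (phi x)%:E = \int[mu]_x (phi x * den P x)%:E)%E.
  move=> Pmu mphi phi0.
  rewrite -(@Radon_Nikodym_SigmaFinite.change_of_variables _ _ _ P mu Pmu (EFin \o phi) setT)//.
  - apply: eq_integral => x _ /=; rewrite EFinM /den fineK//.
    exact: Radon_Nikodym_SigmaFinite.f_fin_num.
  - exact/measurable_EFinP.
have densE (P : probability T R) : P `<< mu -> {ae mu, forall x, den P x = density mu P x}.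
  move=> Pmu; have := ae_eq_Radon_Nikodym_SigmaFinite Pmu measurableT.
  by apply: filterS => x /(_ I); rewrite /den /density => ->.
have msqrt : measurable_fun [set: R] (@Num.sqrt R).
  by apply: continuous_measurable_fun; exact: sqrt_continuous.
have mdiff : measurable_fun setT (fun x => (Num.sqrt (den k x) - Num.sqrt (den Q x)) ^+ 2).
  apply: measurable_funX; apply: measurable_funB.
    exact: (measurableT_comp msqrt (mden _ kmu)).
  exact: (measurableT_comp msqrt (mden _ Qmu)).
have helE : ((hellinger k Q ^+ 2)%:E =
    \int[mu]_x ((Num.sqrt (den k x) - Num.sqrt (den Q x)) ^+ 2)%:E)%E.
  rewrite /hellinger /hellinger_wrt sqr_sqrtr; last first.
    by apply: Rintegral_ge0 => x _; exact: sqr_ge0.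
  have := densE k kmu; have := densE Q Qmu.
  rewrite /Rintegral -/mu => dQ dk.
  have -> : (\int[mu]_x ((Num.sqrt (density mu k x) - Num.sqrt (density mu Q x)) ^+ 2)%:E =
      \int[mu]_x ((Num.sqrt (den k x) - Num.sqrt (den Q x)) ^+ 2)%:E)%E.
    apply: ge0_ae_eq_integral_nonmeasurable => //.
    - by move=> x; rewrite lee_fin sqr_ge0.
    - by move=> x; rewrite lee_fin sqr_ge0.
    - exact/measurable_EFinP.
    - by apply: filterS2 dk dQ => x -> ->.
  rewrite fineK// ge0_fin_numE; last first.
    by apply: integral_ge0 => x _; rewrite lee_fin sqr_ge0.
  apply: (@le_lt_trans _ _ (\int[mu]_x (1 * den k x)%:E + \int[mu]_x (1 * den Q x)%:E)%E).
    rewrite -ge0_integralD//; last 4 first.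
    - by move=> x _; rewrite lee_fin mul1r den0.
    - by apply/measurable_EFinP/measurable_funM => //; exact: mden.
    - by move=> x _; rewrite lee_fin mul1r den0.
    - by apply/measurable_EFinP/measurable_funM => //; exact: mden.
    apply: ge0_le_integral => //.
    - by move=> x _; rewrite lee_fin sqr_ge0.
    - exact/measurable_EFinP.
    - apply/measurable_EFinP/measurable_funD; apply: measurable_funM => //; exact: mden.
    - move=> x _; rewrite -EFinD lee_fin !mul1r.
      have := sqr_sqrtr (den0 k x kmu); have := sqr_sqrtr (den0 Q x Qmu).
      have := sqrtr_ge0 (den k x); have := sqrtr_ge0 (den Q x).
      move: (Num.sqrt _) (Num.sqrt _) => a b a0 b0 <- <-; nra.
  have int1 (P : probability T R) : (\int[P]_x (cst (1 : R) x)%:E = 1)%E.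
    by rewrite -[LHS]/(\int[P]_x cst 1 x)%E integral_cst// mul1e; exact: probability_setT.
  by rewrite -(denE k (cst 1))// -(denE Q (cst 1))// !int1 ltry.
have gp x : 0 <= g^\+ x by exact: funrpos_ge0.
have gn x : 0 <= g^\- x by exact: funrneg_ge0.
have g2 x : 0 <= g x ^+ 2 by exact: sqr_ge0.
have mgp : measurable_fun setT g^\+ by exact: measurable_funrpos.
have mgn : measurable_fun setT g^\- by exact: measurable_funrneg.
have mg2 : measurable_fun setT (fun x => g x ^+ 2) by exact: measurable_funX.
rewrite !(denE k)// !(denE Q)//.
have intD (a b : T -> R) : (forall x, 0 <= a x) -> (forall x, 0 <= b x) ->
    measurable_fun setT a -> measurable_fun setT b ->
    (\int[mu]_x (a x)%:E + \int[mu]_x (b x)%:E = \int[mu]_x (a x + b x)%:E)%E.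
  move=> a0 b0 ma mb; rewrite -ge0_integralD//.
  - by move=> x _; rewrite lee_fin.
  - exact/measurable_EFinP.
  - by move=> x _; rewrite lee_fin.
  - exact/measurable_EFinP.
have intZ (c : R) (a : T -> R) : 0 <= c -> (forall x, 0 <= a x) -> measurable_fun setT a ->
    (c%:E * \int[mu]_x (a x)%:E = \int[mu]_x (c * a x)%:E)%E.
  move=> c0 a0 ma; rewrite -ge0_integralZl_EFin//.
  - by move=> x _; rewrite lee_fin.
  - exact/measurable_EFinP.
have dk0 x : 0 <= den k x by exact: den0.
have dQ0 x : 0 <= den Q x by exact: den0.
have mdk : measurable_fun setT (den k) by exact: mden.
have mdQ : measurable_fun setT (den Q) by exact: mden.
have mM (a b : T -> R) : measurable_fun setT a -> measurable_fun setT b ->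
  measurable_fun setT (fun x => a x * b x) by exact: measurable_funM.
have mD (a b : T -> R) : measurable_fun setT a -> measurable_fun setT b ->
  measurable_fun setT (fun x => a x + b x) by exact: measurable_funD.
have pM (a b : T -> R) : (forall x, 0 <= a x) -> (forall x, 0 <= b x) ->
  forall x, 0 <= a x * b x by move=> a0 b0 x; exact: mulr_ge0.
have pD (a b : T -> R) : (forall x, 0 <= a x) -> (forall x, 0 <= b x) ->
  forall x, 0 <= a x + b x by move=> a0 b0 x; exact: addr_ge0.
rewrite mulrC EFinM helE intZ//; last first.
  by move=> x; exact: sqr_ge0.
  by rewrite invr_ge0 mulr_ge0// ltW.
have lam0' : 0 <= lam by exact: ltW.
have il0 : 0 <= (2 * lam)^-1 by rewrite invr_ge0 mulr_ge0.
have dd0 x : 0 <= (Num.sqrt (den k x) - Num.sqrt (den Q x)) ^+ 2 by exact: sqr_ge0.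
have l0 (x : T) : 0 <= cst lam x by [].
have i0 (x : T) : 0 <= cst ((2 * lam)^-1) x by [].
rewrite (intD _ _ (pM _ _ gp dQ0) (pM _ _ gn dk0) (mM _ _ mgp mdQ) (mM _ _ mgn mdk)).
rewrite (intD _ _ (pM _ _ gp dk0) (pM _ _ gn dQ0) (mM _ _ mgp mdk) (mM _ _ mgn mdQ)).
have p2 := pD _ _ (pM _ _ g2 dk0) (pM _ _ g2 dQ0).
have m2 := mD _ _ (mM _ _ mg2 mdk) (mM _ _ mg2 mdQ).
rewrite (intD _ _ (pM _ _ g2 dk0) (pM _ _ g2 dQ0) (mM _ _ mg2 mdk) (mM _ _ mg2 mdQ)).
rewrite (intZ _ _ lam0' p2 m2).
have p3 := pD _ _ (pM _ _ gp dk0) (pM _ _ gn dQ0).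
have m3 := mD _ _ (mM _ _ mgp mdk) (mM _ _ mgn mdQ).
have ml := mM _ _ (measurable_cst lam) m2.
have mi := mM _ _ (measurable_cst ((2 * lam)^-1)) mdiff.
rewrite (intD _ _ p3 (pM _ _ l0 p2) m3 ml).
have p4 := pD _ _ p3 (pM _ _ l0 p2).
have m4 := mD _ _ m3 ml.
rewrite (intD _ _ p4 (pM _ _ i0 dd0) m4 mi).
apply: ge0_le_integral => //.
- by move=> x _; rewrite lee_fin; exact: (pD _ _ (pM _ _ gp dQ0) (pM _ _ gn dk0)).
- by apply/measurable_EFinP; exact: (mD _ _ (mM _ _ mgp mdQ) (mM _ _ mgn mdk)).
- by apply/measurable_EFinP; exact: (mD _ _ m4 mi).
move=> x _; rewrite lee_fin /=.
have -> : g x = g^\+ x - g^\- x by rewrite -[in LHS](funrposBneg g).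
exact: hellinger_pointwise.
Qed.

(** * Inner product, dual norm and Borel measurability in row vectors *)

Section inner_product.
Context {R : realType} {p : nat}.
Implicit Types x y z : 'rV[R]_p.

Lemma innerDr x y z : inner x (y + z) = inner x y + inner x z.
Proof. by rewrite -big_split; apply: eq_bigr => i _; rewrite mxE mulrDr. Qed.

Lemma innerDl x y z : inner (y + z) x = inner y x + inner z x.
Proof. by rewrite -big_split; apply: eq_bigr => i _; rewrite mxE mulrDl. Qed.

Lemma innerNr x y : inner x (- y) = - inner x y.
Proof. by rewrite -sumrN; apply: eq_bigr => i _; rewrite mxE mulrN. Qed.

Lemma innerNl x y : inner (- x) y = - inner x y.
Proof. by rewrite -sumrN; apply: eq_bigr => i _; rewrite mxE mulNr. Qed.

Lemma innerZr (a : R) x y : inner x (a *: y) = a * inner x y.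
Proof. by rewrite mulr_sumr; apply: eq_bigr => i _; rewrite mxE mulrCA. Qed.

Lemma innerBr x y z : inner x (y - z) = inner x y - inner x z.
Proof. by rewrite innerDr innerNr. Qed.

Lemma innerBl x y z : inner (y - z) x = inner y x - inner z x.
Proof. by rewrite innerDl innerNl. Qed.

Lemma inner0r x : inner x 0 = 0.
Proof. by rewrite -[0](subrr 0) innerBr subrr. Qed.

Lemma inner_continuous x : continuous (fun y => inner y x).
Proof.
rewrite /inner; elim: (index_enum _) => [|i r IH] y.
  rewrite (_ : (fun _ => _) = cst 0); last by apply/funext => z; rewrite big_nil.
  exact: (@cst_continuous _ R^o).
rewrite (_ : (fun _ => _) =
    (fun z : 'rV[R]_p => z 0 i * x 0 i + \sum_(j <- r) z 0 j * x 0 j)); last first.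
  by apply/funext => z; rewrite big_cons.
apply: (@cvgD R R^o _ (nbhs y) _ (fun z : 'rV[R]_p => z 0 i * x 0 i)
  (fun z => \sum_(j <- r) z 0 j * x 0 j)); last exact: IH.
apply: (@continuousM _ _ (fun z : 'rV[R]_p => z 0 i) (cst (x 0 i))).
  exact: coord_continuous.
exact: cst_continuous.
Qed.

End inner_product.

Section borel_measurability.
Context {R : realType}.

Lemma open_borel k (A : set 'rV[R]_k) :
  open A -> measurable (A : set (borel R k)).
Proof. exact: sub_sigma_algebra. Qed.

Lemma closed_borel k (A : set 'rV[R]_k) :
  closed A -> measurable (A : set (borel R k)).
Proof.
move=> cA; rewrite -[A]setCK; apply: measurableC; apply: open_borel.
exact: closed_openC.
Qed.

Lemma continuous_borel_real k (f : 'rV[R]_k -> R) :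
  continuous f -> measurable_fun setT (f : borel R k -> R).
Proof.
move=> cf; apply: (measurability _ (RGenOInfty.measurableE R)) => //.
move=> _ [_ [a ->] <-]; rewrite setTI; apply: open_borel.
by apply: open_comp; [move=> y _; exact: cf|exact: interval_open].
Qed.

Lemma continuous_borel k l (f : 'rV[R]_k -> 'rV[R]_l) :
  continuous f -> measurable_fun setT (f : borel R k -> borel R l).
Proof.
move=> cf; apply: (@measurability _ _ (borel R k) (borel R l) setT f (@open 'rV[R]_l) erefl).
move=> _ [A oA <-]; rewrite setTI; apply: open_borel.
by apply: open_comp; first by move=> y _; exact: cf.
Qed.

Lemma measurable_inner {d} {T : measurableType d} (D : set T) k
    (u v : T -> 'rV[R]_k) :
  measurable_fun D (u : T -> borel R k) -> measurable_fun D (v : T -> borel R k) ->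
  measurable_fun D (fun x => inner (u x) (v x)).
Proof.
move=> mu mv; rewrite /inner.
have mc (w : T -> 'rV[R]_k) i : measurable_fun D (w : T -> borel R k) ->
    measurable_fun D (fun x => w x 0 i).
  move=> mw; have mi : measurable_fun setT (fun y : borel R k => (y : 'rV[R]_k) 0 i).
    by apply: continuous_borel_real => y; exact: coord_continuous.
  exact: measurableT_comp mi mw.
by apply: measurable_sum => i; apply: measurable_funM; exact: mc.
Qed.

End borel_measurability.

Section dual_pairing.
Context {R : realType} {p : nat} (nrm : 'rV[R]_p -> R).
Hypothesis nrm_norm : is_norm nrm.
Implicit Types x y : 'rV[R]_p.

Lemma is_norm0 : nrm 0 = 0.
Proof. by have [_ nZ _] := nrm_norm; rewrite -(scale0r 0) nZ normr0 mul0r. Qed.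

Lemma is_normN x : nrm (- x) = nrm x.
Proof. by have [_ nZ _] := nrm_norm; rewrite -scaleN1r nZ normrN normr1 mul1r. Qed.

Lemma is_norm_ge0 x : 0 <= nrm x.
Proof.
have [nD _ _] := nrm_norm; have := nD x (- x).
by rewrite subrr is_norm0 is_normN -mulr2n pmulrn_lge0.
Qed.

Lemma is_norm_le : exists2 C, 0 <= C & forall x, nrm x <= C * `|x|.
Proof.
have [nD nZ _] := nrm_norm.
exists (\sum_(i < p) nrm (delta_mx 0 i)).
  by apply: sumr_ge0 => i _; exact: is_norm_ge0.
move=> x; rewrite {1}(row_sum_delta x) mulr_suml.
elim/big_rec2 : _ => [|i a b _ ba]; first by rewrite is_norm0.
apply: le_trans (nD _ _) _; apply: lerD => //.
rewrite nZ mulrC ler_wpM2l ?is_norm_ge0//.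
rewrite [leRHS]/Num.norm /= mx_normrE.
by rewrite (le_bigmax _ (fun ij => `|x ij.1 ij.2|) (0, i)).
Qed.

Lemma is_norm_continuous : continuous (nrm : 'rV[R]_p -> R).
Proof.
have [C C0 nC] := is_norm_le; have [nD _ _] := nrm_norm.
move=> x; apply/(@cvgrPdist_lt _ _ _ (nbhs x)) => e e0; apply/nbhs_ballP.
exists (e / (C + 1)); first by rewrite /= divr_gt0// ltr_wpDl.
move=> y; rewrite -ball_normE /= => xy.
have h a b : nrm a - nrm b <= C * `|a - b|.
  by rewrite lerBlDr (le_trans _ (lerD (nC _) (lexx _)))// -[leLHS](congr1 nrm (subrK b a)).
have : `|nrm x - nrm y| <= C * `|x - y|.
  by rewrite ler_norml h andbT -[leRHS]opprB lerN2 distrC.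
move=> /le_lt_trans; apply.
rewrite ltr_pdivlMr ?ltr_wpDl// in xy.
apply: le_lt_trans xy; rewrite mulrDr mulr1 [C * _]mulrC lerDl; exact: normr_ge0.
Qed.

(** The infimum of [nrm] over the compact unit sphere of the maximum norm is
    attained, hence positive. *)
Lemma norm_le_is_norm : exists2 c, 0 < c & forall x, `|x| <= c * nrm x.
Proof.
have [nD nZ n0] := nrm_norm.
pose S := [set x : 'rV[R]_p | `|x| = 1].
have unit x : x != 0 -> S (`|x|^-1 *: x).
  by move=> x0; rewrite /S/= normrZ normfV normr_id mulVf// normr_eq0.
have [S0|/set0P S0] := eqVneq S set0.
  exists 1 => // x; have [->|/unit] := eqVneq x 0; last by rewrite S0.
  by rewrite normr0 mul1r is_norm_ge0.
have cS : compact S.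
  apply: bounded_closed_compact.
    by exists 1; split => // M M1 x /= ->; exact: ltW.
  rewrite (_ : S = (@Num.norm _ 'rV[R]_p) @^-1` [set 1])//.
  by apply: closed_comp => [x _|]; [exact: norm_continuous|exact: closed_eq].
have := EVT_min_rV S0 cS (continuous_subspaceT is_norm_continuous).
move=> [s]; rewrite inE => S1 smin.
have s0 : 0 < nrm s.
  rewrite lt0r is_norm_ge0 andbT; apply/eqP => /n0 s0.
  by move: S1; rewrite /S /= s0 normr0 => /eqP; rewrite eq_sym oner_eq0.
exists (nrm s)^-1; first by rewrite invr_gt0.
move=> x; have [->|x0] := eqVneq x 0; first by rewrite normr0 is_norm0 mulr0.
have nx0 : 0 < `|x| by rewrite normr_gt0.
rewrite ler_pdivlMl//.
have := smin _ (mem_set (unit x x0)).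
by rewrite nZ normfV normr_id ler_pdivlMl// mulrC.
Qed.

Let has_sup_dual y : has_sup [set inner y x | x in [set x | nrm x <= 1]].
Proof.
have [c c0 xc] := norm_le_is_norm.
split; first by exists (inner y 0), 0 => //=; rewrite is_norm0 ler01.
exists (\sum_(i < p) `|y 0 i| * c) => _ [x /= x1 <-].
apply: ler_sum => i _; rewrite (le_trans (ler_norm _))// normrM ler_wpM2l//.
apply: (@le_trans _ _ `|x|); last first.
  by rewrite (le_trans (xc x))// -[leRHS]mulr1 ler_wpM2l// ltW.
rewrite [leRHS]/Num.norm /= mx_normrE.
by rewrite (le_bigmax _ (fun ij => `|x ij.1 ij.2|) (0, i)).
Qed.

Lemma dual_norm_ge0 y : 0 <= dual_norm nrm y.
Proof.
apply: sup_upper_bound; first exact: has_sup_dual.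
by exists 0; rewrite ?inner0r//= is_norm0 ler01.
Qed.

Lemma inner_le_dual_norm y x : inner y x <= dual_norm nrm y * nrm x.
Proof.
have [nD nZ n0] := nrm_norm.
have [->|x0] := eqVneq x 0; first by rewrite inner0r is_norm0 mulr0.
have nx0 : 0 < nrm x.
  by rewrite lt0r is_norm_ge0 andbT; apply: contra_neq x0; exact: n0.
rewrite -ler_pdivrMr// mulrC -innerZr.
apply: sup_upper_bound; first exact: has_sup_dual.
exists ((nrm x)^-1 *: x) => //=.
by rewrite nZ ger0_norm ?invr_ge0 ?is_norm_ge0// mulVf ?gt_eqF.
Qed.

(** As a supremum of continuous functions the dual norm is lower semicontinuous:
    each set where it exceeds [a] is a union of open half-spaces. *)
Lemma measurable_dual_norm :
  measurable_fun setT (fun y : borel R p => dual_norm nrm y).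
Proof.
apply: (measurability _ (RGenOInfty.measurableE R)) => //.
move=> _ [_ [a ->] <-]; rewrite setTI.
apply: sub_sigma_algebra.
rewrite (_ : _ @^-1` _ =
  \bigcup_(x in [set x | nrm x <= 1]) ((fun y => inner y x) @^-1` `]a, +oo[)).
  apply: bigcup_open => x _.
  apply: open_comp; last exact: interval_open.
  by move=> y _; exact: inner_continuous.
apply/seteqP; split => y /=.
  rewrite in_itv/= andbT => /(sup_gt (has_sup_dual y).1)[_ [x x1 <-] ax].
  by exists x => //=; rewrite in_itv/= ax.
move=> [x x1] /=; rewrite !in_itv/= !andbT => ax.
rewrite (lt_le_trans ax)//.
by apply: sup_upper_bound; [exact: has_sup_dual|exists x].
Qed.


End dual_pairing.

(** * Gradients and one-sided difference quotients *)

Section mirror_map.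
Context {R : realType} {p : nat}.
Implicit Types x y v : 'rV[R]_p.

Lemma convex_set_segment (A : set 'rV[R]_p) x y (s : R) :
  convex_set A -> A x -> A y -> 0 <= s <= 1 -> A (s *: (x - y) + y).
Proof.
move=> cA Ax Ay /andP[s0 s1].
have := cA x y (Itv01 s0 s1) (mem_set Ax) (mem_set Ay); rewrite inE.
congr (A _); rewrite /conv/= /unstable.onem scalerBr scalerBl scale1r.
by rewrite addrAC addrA.
Qed.

Lemma derive_gradient (f : 'rV[R]_p -> R) y v :
  differentiable (f : 'rV[R]_p -> R^o) y ->
  'D_v (f : 'rV[R]_p -> R^o) y = inner (gradient f y) v.
Proof.
move=> df; rewrite deriveE// {1}(row_sum_delta v) linear_sum.
by apply: eq_bigr => i _; rewrite linearZ/= mxE deriveE// mulrC.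
Qed.

Lemma gradient_cvg (f : 'rV[R]_p -> R) y v :
  differentiable (f : 'rV[R]_p -> R^o) y ->
  (fun h => h^-1 * (f (h *: v + y) - f y)) @ 0^'+ --> inner (gradient f y) v.
Proof.
move=> df; rewrite -derive_gradient//.
have dv := @diff_derivable _ _ _ _ _ v df.
have : (fun h => h^-1 *: ((f \o shift y) (h *: v) - f y)) @ 0^' --> 'D_v (f : 'rV[R]_p -> R^o) y.
  exact: dv.
apply: cvg_trans; apply: cvg_app => A.
rewrite /dnbhs /at_right /within /=; apply: (@filterS _ (nbhs (0 : R))) => u hu u0.
by apply: hu; rewrite gt_eqF.
Qed.

(** Convexity controls only difference quotients along segments that stay in the
    domain, so the gradient is bounded through right limits at [0]; [c] absorbs
    the quadratic error of strong convexity. *)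
Lemma gradient_le (f : 'rV[R]_p -> R) y v b c :
  differentiable (f : 'rV[R]_p -> R^o) y ->
  (forall s, 0 < s <= 1 -> f (s *: v + y) - f y <= s * (b + s * c)) ->
  inner (gradient f y) v <= b.
Proof.
move=> df fb.
have bc : (fun h : R => b + h * c) @ 0^'+ --> b.
  rewrite -[X in _ --> X]addr0 -{2}(mul0r c).
  apply: cvgD; first exact: cvg_cst.
  apply: cvgM; last exact: cvg_cst.
  by apply: cvg_at_right_filter; exact: cvg_id.
apply: (ler_cvg_to (@gradient_cvg f y v df) bc).
near=> h; have h0 : 0 < h by near: h; exact: nbhs_right_gt.
rewrite ler_pdivrMl//; apply: fb; rewrite h0/=.
by near: h; apply: nbhs_right_le.
Unshelve. all: by end_near. Qed.

Lemma gradient_ge (f : 'rV[R]_p -> R) y v b :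
  differentiable (f : 'rV[R]_p -> R^o) y ->
  (forall s, 0 < s <= 1 -> s * b <= f (s *: v + y) - f y) ->
  b <= inner (gradient f y) v.
Proof.
move=> df fb; apply: (cvgr_to_ge (@gradient_cvg f y v df)).
near=> h; have h0 : 0 < h by near: h; exact: nbhs_right_gt.
rewrite ler_pdivlMl//; apply: fb; rewrite h0/=.
by near: h; apply: nbhs_right_le.
Unshelve. all: by end_near. Qed.

End mirror_map.

(** * Bregman divergences, one mirror step and subgradient sums *)

Section bregman_theory.
Context {R : realType} {p : nat} (nrm : 'rV[R]_p -> R).
Hypothesis nrm_norm : is_norm nrm.
Context (Theta NTheta : set 'rV[R]_p) (psi : 'rV[R]_p -> R).
Hypothesis Theta_convex : convex_set Theta.
Hypothesis Theta_NTheta : Theta `<=` NTheta.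
Hypothesis psi_diff :
  forall t, NTheta t -> differentiable (psi : 'rV[R]_p -> R^o) t.
Hypothesis psi_convex : strongly_convex_function 1 nrm NTheta psi.
Implicit Types x y t k : 'rV[R]_p.

Lemma bregman_refl x : bregman psi x x = 0.
Proof. by rewrite /bregman !subrr inner0r subr0. Qed.

(** Strong convexity on the segment from [y] to [x] bounds the difference
    quotients at [y] by [psi x - psi y - (1 - s) nrm (x - y)^2 / 2]; let [s]
    tend to [0]. *)
Lemma bregman_ge x y : Theta x -> Theta y ->
  nrm (x - y) ^+ 2 / 2 <= bregman psi x y.
Proof.
move=> Tx Ty; have dy := psi_diff (Theta_NTheta Ty).
suff : inner (gradient psi y) (x - y) <= psi x - psi y - nrm (x - y) ^+ 2 / 2.
  by rewrite /bregman; lra.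
apply: (gradient_le (c := nrm (x - y) ^+ 2 / 2) dy) => s /andP[s0 s1].
have : psi (s *: x + (1 - s) *: y) <= s * psi x + (1 - s) * psi y
    - 1 / 2 * (s * (1 - s)) * nrm (x - y) ^+ 2.
  exact: (psi_convex (Itv01 (ltW s0) s1) (mem_set (Theta_NTheta Tx))
    (mem_set (Theta_NTheta Ty))).
have -> : s *: x + (1 - s) *: y = s *: (x - y) + y.
  by rewrite scalerBr scalerBl scale1r addrAC addrA.
lra.
Qed.

Lemma bregman_three_points x y t :
  inner (gradient psi y - gradient psi x) (t - y) =
  bregman psi t x - bregman psi t y - bregman psi y x.
Proof. by rewrite /bregman innerBl !innerBr; ring. Qed.

Section step.
Context (k x y : 'rV[R]_p) (eta : R).
Hypothesis eta0 : 0 < eta.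
Hypothesis Tx : Theta x.
Hypothesis ymin : is_argmin Theta (fun t => inner k t + eta^-1 * bregman psi t x) y.

(** First-order optimality of the minimiser [y] in the feasible direction
    [t - y], rewritten by the three-point identity. *)
Lemma mirror_step_optimality t : Theta t ->
  inner k (y - t) <=
  eta^-1 * (bregman psi t x - bregman psi t y - bregman psi y x).
Proof.
move=> Tt; have [Ty ymin'] := ymin.
have : inner (gradient psi x) (t - y) - eta * inner k (t - y) <=
    inner (gradient psi y) (t - y).
  apply: gradient_ge; first exact/psi_diff/Theta_NTheta.
  move=> s /andP[s0 s1].
  have Ts : Theta (s *: (t - y) + y).
    by apply: convex_set_segment => //; rewrite ltW.
  have h := ymin' _ Ts; rewrite /bregman -subr_ge0 in h.
  have {h} := mulr_ge0 (ltW eta0) h.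
  rewrite !(innerBr, innerDr, innerZr).
  move: (inner (gradient psi x) t) (inner (gradient psi x) y) (inner (gradient psi x) x) => c e g.
  move: (inner k t) (inner k y) => a b h.
  have {h} : 0 <= eta * (s * (a - b)) + (psi (s *: (t - y) + y) - psi y) - s * (c - e).
    rewrite (le_trans h)// le_eqVlt; apply/orP; left; apply/eqP.
    by field; rewrite gt_eqF.
  lra.
rewrite -bregman_three_points ler_pdivlMl// innerBl !innerBr.
lra.
Qed.

(** Optimality tested at the previous iterate, where both Bregman divergences
    are at least [nrm (y - x)^2 / 2]. *)
Lemma mirror_step_drift : nrm (y - x) <= eta * dual_norm nrm k.
Proof.
have [Ty _] := ymin.
have := mirror_step_optimality Tx; rewrite bregman_refl sub0r ler_pdivlMl//.
have := bregman_ge Tx Ty; have := bregman_ge Ty Tx.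
have -> : nrm (x - y) = nrm (y - x) by rewrite -(is_normN nrm_norm) opprB.
have := inner_le_dual_norm nrm_norm k (x - y).
have -> : nrm (x - y) = nrm (y - x) by rewrite -(is_normN nrm_norm) opprB.
have := is_norm_ge0 nrm_norm (y - x); rewrite le_eqVlt => /predU1P[<- _ _ _ _|n0].
  by rewrite mulr_ge0 ?dual_norm_ge0// ltW.
rewrite !innerBr => h1 h2 h3 h4.
rewrite -(ler_pM2r n0); have := ler_wpM2l (ltW eta0) h1.
lra.
Qed.

(** The divergence [bregman psi y x] of the step pays for [inner k (x - y)]
    by the inequality between arithmetic and geometric means. *)
Lemma mirror_step_regret t : Theta t ->
  inner k (x - t) <=
  eta^-1 * (bregman psi t x - bregman psi t y) + eta / 2 * dual_norm nrm k ^+ 2.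
Proof.
move=> Tt; have [Ty _] := ymin.
have := mirror_step_optimality Tt; have := bregman_ge Ty Tx.
have := inner_le_dual_norm nrm_norm k (x - y).
have -> : nrm (x - y) = nrm (y - x) by rewrite -(is_normN nrm_norm) opprB.
have : 0 <= (eta / 2) * (dual_norm nrm k - eta^-1 * nrm (y - x)) ^+ 2.
  by rewrite mulr_ge0 ?sqr_ge0// divr_ge0// ltW.
rewrite (_ : eta / 2 * (dual_norm nrm k - eta^-1 * nrm (y - x)) ^+ 2 =
  eta / 2 * dual_norm nrm k ^+ 2 - dual_norm nrm k * nrm (y - x) + eta^-1 * (nrm (y - x) ^+ 2 / 2)); last first.
  by field; rewrite gt_eqF.
rewrite !innerBr => h1 h2 h3 h4.
have : eta^-1 * (nrm (y - x) ^+ 2 / 2) <= eta^-1 * bregman psi y x.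
  by rewrite ler_wpM2l// invr_ge0 ltW.
lra.
Qed.

End step.
End bregman_theory.

(** Abel summation; the last divergence is kept on the right so that the
    induction goes through. *)
Lemma weighted_telescope {R : realFieldType} (eta B : nat -> R) (C : R) a n :
  (0 < a)%N -> (forall i, (0 < i)%N -> 0 < eta i) ->
  (forall i j, (0 < i)%N -> (i <= j)%N -> eta j <= eta i) ->
  (forall i, (a <= i <= a + n.+1)%N -> 0 <= B i <= C) ->
  \sum_(a <= i < a + n.+1) (eta i)^-1 * (B i - B i.+1) <=
  (C - B (a + n.+1)%N) / eta (a + n)%N.
Proof.
move=> a0 eta0 mono; elim: n => [|n IH] BC.
  rewrite addn1 addn0 big_nat1 mulrC ler_wpM2r ?invr_ge0 ?(ltW (eta0 _ _))// lerD2r.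
  by have /andP[] := BC a ltac:(nat_lia).
rewrite addnS big_nat_recr/=; last by nat_lia.
have {}IH := IH ltac:(move=> i ai; apply: BC; nat_lia).
apply: le_trans (lerD IH (lexx _)) _.
have h : (C - B (a + n.+1)%N) / eta (a + n)%N <= (C - B (a + n.+1)%N) / eta (a + n.+1)%N.
  rewrite ler_wpM2l//.
    by have /andP[] := BC (a + n.+1)%N ltac:(nat_lia); rewrite subr_ge0.
  rewrite lef_pV2 ?posrE ?eta0; try nat_lia.
  by apply: mono; nat_lia.
apply: le_trans (lerD h (lexx _)) _.
by rewrite le_eqVlt; apply/orP; left; apply/eqP; ring.
Qed.

(** Each [eta j] of a window starting at [i] is at most [eta i]. *)
Lemma window_sum_le {R : realFieldType} (eta : nat -> R) m q n :
  (forall i, (0 < i)%N -> 0 < eta i) ->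
  (forall i j, (0 < i)%N -> (i <= j)%N -> eta j <= eta i) -> (q <= n)%N ->
  \sum_(1 <= i < q.+1) \sum_(i <= j < i + m) eta j <=
  m%:R * \sum_(1 <= i < n.+1) eta i.
Proof.
move=> eta0 mono qn.
apply: (@le_trans _ _ (\sum_(1 <= i < q.+1) m%:R * eta i)).
  rewrite big_nat_cond [leRHS]big_nat_cond; apply: ler_sum => i /andP[/andP[i0 _] _].
  rewrite mulr_natl -[X in _ *+ X](addKn i m) -sumr_const_nat.
  rewrite big_nat_cond [leRHS]big_nat_cond; apply: ler_sum => j /andP[/andP[ij _] _].
  exact: mono.
rewrite -mulr_sumr; apply: ler_wpM2l => //.
rewrite [leRHS](big_cat_nat (n := q.+1))//= lerDl big_nat_cond.
apply: sumr_ge0 => i /andP[/andP[qi _] _]; apply/ltW/eta0; exact: leq_trans qi.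
Qed.

Lemma subgradient_increment {R : realType} {p : nat} (A : set 'rV[R]_p)
    (f : 'rV[R]_p -> R) (k x y : 'rV[R]_p) :
  subdifferential A f x k -> A y -> inner k (y - x) <= f y - f x.
Proof. by move=> fk /fk; rewrite lerBrDl. Qed.

Definition subgradient_riemann {R : realType} {p : nat}
  (g : 'rV[R]_p -> 'rV[R]_p) (a b : 'rV[R]_p) (N : nat) : R :=
  N.+1%:R^-1 *
  \sum_(0 <= k < N.+1) inner (g ((k%:R / N.+1%:R) *: (b - a) + a)) (b - a).

Section riemann_subgradient.
Context {R : realType} {p : nat} (A D : set 'rV[R]_p) (f : 'rV[R]_p -> R)
  (g : 'rV[R]_p -> 'rV[R]_p).
Hypothesis A_convex : convex_set A.
Hypothesis AD : A `<=` D.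
Hypothesis g_sub : forall t, A t -> subdifferential D f t (g t).

(** On a subinterval of the segment the increment of [f] lies between the values
    given by the subgradients at its two endpoints; the lower and upper sums
    differ only by their first and last terms. *)
Lemma subgradient_riemann_bounds a b N : A a -> A b ->
  subgradient_riemann g a b N <= f b - f a <=
  subgradient_riemann g a b N + N.+1%:R^-1 * (inner (g b) (b - a) - inner (g a) (b - a)).
Proof.
move=> Aa Ab; rewrite /subgradient_riemann; set v := b - a.
pose c k := (k%:R / N.+1%:R) *: v + a.
have N0 : 0 < N.+1%:R :> R by rewrite ltr0n.
have Ac k : (k <= N.+1)%N -> A (c k).
  move=> kN; apply: convex_set_segment => //.
  by rewrite divr_ge0//= ler_pdivrMr// mul1r ler_nat.
have c0 : c 0%N = a by rewrite /c mul0r scale0r add0r.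
have cN : c N.+1 = b by rewrite /c divff ?gt_eqF// scale1r subrK.
have cS k : c k.+1 - c k = N.+1%:R^-1 *: v.
  rewrite /c opprD addrACA subrr addr0 -scalerBl -mulrBl -natrB//.
  by rewrite subSnn mul1r.
have tel : f b - f a = \sum_(0 <= k < N.+1) (f (c k.+1) - f (c k)).
  by rewrite telescope_sumr// c0 cN.
have telg : inner (g b) v - inner (g a) v =
    \sum_(0 <= k < N.+1) (inner (g (c k.+1)) v - inner (g (c k)) v).
  by rewrite (telescope_sumr (fun k => inner (g (c k)) v))// c0 cN.
rewrite -mulrDr telg -big_split/= tel !mulr_sumr; apply/andP; split.
  rewrite big_nat_cond [leRHS]big_nat_cond; apply: ler_sum => k /andP[/andP[_ kN] _].
  rewrite -innerZr -(cS k); apply: (subgradient_increment (g_sub (Ac _ (ltnW kN)))).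
  exact/AD/Ac.
rewrite big_nat_cond [leRHS]big_nat_cond; apply: ler_sum => k /andP[/andP[_ kN] _].
rewrite [_ + (_ - _)]addrC subrK -innerZr -(cS k) -lerN2 -innerNr !opprB.
apply: (subgradient_increment (g_sub (Ac _ kN))); exact/AD/Ac/ltnW.
Qed.

Lemma subgradient_riemann_cvg a b : A a -> A b ->
  subgradient_riemann g a b @ \oo --> f b - f a.
Proof.
move=> Aa Ab; set e := inner (g b) (b - a) - inner (g a) (b - a).
apply: (@squeeze_cvgr _ _ _ _ (fun N => f b - f a - N.+1%:R^-1 * e) (cst (f b - f a))).
- apply: nearW => N; have /andP[h1 h2] := subgradient_riemann_bounds N Aa Ab.
  by rewrite h1 andbT lerBlDr.
- rewrite -[X in _ --> X]subr0 -[in X in _ --> X](mul0r e).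
  apply: cvgB; first exact: cvg_cst.
  by apply: cvgM; [exact: cvg_harmonic|exact: cvg_cst].
- exact: cvg_cst.
Qed.

End riemann_subgradient.

(** * Regret of mirror descent with delayed losses *)

Section subgradient_gap.
Context {R : realType} {p : nat} (nrm : 'rV[R]_p -> R).
Hypothesis nrm_norm : is_norm nrm.
Context (Theta NTheta : set 'rV[R]_p) (Rad : R).
Hypothesis Theta_NTheta : Theta `<=` NTheta.
Hypothesis Theta_diam : forall s t, Theta s -> Theta t -> nrm (s - t) <= Rad.

Lemma subgradient_gap (h : 'rV[R]_p -> R) k s t :
  Theta s -> Theta t -> subdifferential NTheta h s k ->
  h s - h t <= Rad * dual_norm nrm k.
Proof.
move=> Ts Tt hk.
have := subgradient_increment hk (Theta_NTheta Tt).
have := inner_le_dual_norm nrm_norm k (s - t).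
have := ler_wpM2l (dual_norm_ge0 nrm_norm k) (Theta_diam Ts Tt).
by rewrite !innerBr; lra.
Qed.

(** Whichever of [h s] and [h t] is larger, the subgradient at that point bounds
    the difference. *)
Lemma subgradient_gap_sqr (h : 'rV[R]_p -> R) k l s t :
  Theta s -> Theta t ->
  subdifferential NTheta h s k -> subdifferential NTheta h t l ->
  (h s - h t) ^+ 2 <= Rad ^+ 2 * (dual_norm nrm k ^+ 2 + dual_norm nrm l ^+ 2).
Proof.
move=> Ts Tt hk hl.
have := subgradient_gap Ts Tt hk; have := subgradient_gap Tt Ts hl.
have := dual_norm_ge0 nrm_norm k; have := dual_norm_ge0 nrm_norm l.
move: (dual_norm nrm k) (dual_norm nrm l) (h s) (h t) => a b u v b0 a0 uv vu.
have [le_uv|lt_vu] := leP u v.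
  have : (v - u) * (v - u) <= (Rad * b) * (Rad * b) by apply: ler_pM => //; lra.
  have : 0 <= Rad ^+ 2 * a ^+ 2 by rewrite mulr_ge0 ?sqr_ge0.
  by lra.
have : (u - v) * (u - v) <= (Rad * a) * (Rad * a) by apply: ler_pM => //; lra.
have : 0 <= Rad ^+ 2 * b ^+ 2 by rewrite mulr_ge0 ?sqr_ge0.
by lra.
Qed.

End subgradient_gap.

Section mirror_descent.
Context {R : realType} {p : nat} (nrm : 'rV[R]_p -> R).
Hypothesis nrm_norm : is_norm nrm.
Context (Theta NTheta : set 'rV[R]_p) (psi : 'rV[R]_p -> R).
Hypothesis Theta_convex : convex_set Theta.
Hypothesis Theta_NTheta : Theta `<=` NTheta.
Hypothesis psi_diff :
  forall t, NTheta t -> differentiable (psi : 'rV[R]_p -> R^o) t.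
Hypothesis psi_convex : strongly_convex_function 1 nrm NTheta psi.
Context (Rad : R).
Hypothesis Rad_gt0 : 0 < Rad.
Hypothesis Rad_bound : forall t1 t2, Theta t1 -> Theta t2 ->
  bregman psi t1 t2 <= Rad ^+ 2 / 2.

Lemma diameter_le_radius s t : Theta s -> Theta t -> nrm (s - t) <= Rad.
Proof.
move=> Ts Tt.
have := le_trans (bregman_ge Theta_NTheta psi_diff psi_convex Ts Tt) (Rad_bound Ts Tt).
rewrite ler_pM2r ?invr_gt0// ler_pXn2r// ?nnegrE ?is_norm_ge0//; exact: ltW.
Qed.

Context (eta : nat -> R) (n : nat).
Hypothesis eta_gt0 : forall i, (0 < i)%N -> 0 < eta i.
Hypothesis eta_noninc : forall i j, (0 < i)%N -> (i <= j)%N -> eta j <= eta i.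
Context (k : nat -> 'rV[R]_p -> 'rV[R]_p) (th : nat -> 'rV[R]_p).
Hypothesis th1 : Theta (th 1%N).
Hypothesis th_step : forall i, (0 < i <= n)%N ->
  is_argmin Theta
    (fun t => inner (k i (th i)) t + (eta i)^-1 * bregman psi t (th i))
    (th i.+1).

Lemma iterate_in i : (0 < i <= n.+1)%N -> Theta (th i).
Proof.
case: i => [//|[|i]] // iN; have [|Ti _] := th_step (i := i.+1); first nat_lia.
exact: Ti.
Qed.

Local Notation dn i := (dual_norm nrm (k i (th i))).

Lemma iterate_drift i m : (0 < i)%N -> (i + m <= n.+1)%N ->
  nrm (th i - th (i + m)%N) <= \sum_(i <= j < i + m) eta j * dn j.
Proof.
move=> i0; elim: m => [|m IH] imn.
  by rewrite addn0 subrr (is_norm0 nrm_norm) big_geq.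
rewrite addnS big_nat_recr/=; last by nat_lia.
have [nD _ _] := nrm_norm.
have -> : th i - th (i + m).+1 = (th i - th (i + m)%N) + (th (i + m)%N - th (i + m).+1).
  by rewrite addrA subrK.
apply: le_trans (nD _ _) _; apply: lerD; first by apply: IH; nat_lia.
rewrite -(is_normN nrm_norm) opprB.
have imn' : (0 < i + m <= n)%N by nat_lia.
apply: (mirror_step_drift nrm_norm Theta_convex Theta_NTheta psi_diff psi_convex) (th_step imn').
  by apply: eta_gt0; nat_lia.
by apply: iterate_in; nat_lia.
Qed.

Hypothesis n_gt0 : (0 < n)%N.
Context (h : nat -> 'rV[R]_p -> R).
Hypothesis k_sub : forall i, (0 < i <= n)%N ->
  forall t, Theta t -> subdifferential NTheta (h i) t (k i t).

(** The steps preceding [m.+1] contribute nonnegative terms to the last sum, so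
    the bound can be stated with the full range. *)
Lemma regret_le m t : Theta t ->
  \sum_(1 <= i < (n - m).+1) (h (i + m) (th (i + m)) - h (i + m) t) <=
  Rad ^+ 2 / (2 * eta n) + \sum_(1 <= i < n.+1) eta i / 2 * dn i ^+ 2.
Proof.
move=> Tt.
have pos i : (0 < i)%N -> 0 <= eta i / 2 * dn i ^+ 2.
  by move=> i0; rewrite mulr_ge0 ?sqr_ge0// divr_ge0// ltW// eta_gt0.
have [nm|mn] := leqP n m.
  rewrite (_ : (n - m).+1 = 1%N); last by nat_lia.
  rewrite big_geq//; apply: addr_ge0.
    by rewrite divr_ge0 ?sqr_ge0// mulr_ge0// ltW// eta_gt0.
  by rewrite big_nat_cond; apply: sumr_ge0 => i /andP[/andP[i0 _] _]; exact: pos.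
have -> : \sum_(1 <= i < (n - m).+1) (h (i + m) (th (i + m)) - h (i + m) t) =
    \sum_(m.+1 <= i < m.+1 + (n - m.+1).+1) (h i (th i) - h i t).
  rewrite (_ : m.+1 + (n - m.+1).+1 = n.+1)%N; last by nat_lia.
  by rewrite -[m.+1]add1n big_addn (_ : n.+1 - m = (n - m).+1)%N; last by nat_lia.
apply: (@le_trans _ _ (\sum_(m.+1 <= i < m.+1 + (n - m.+1).+1)
   ((eta i)^-1 * (bregman psi t (th i) - bregman psi t (th i.+1)) + eta i / 2 * dn i ^+ 2))).
  rewrite big_nat_cond [leRHS]big_nat_cond; apply: ler_sum => i /andP[/andP[im iN] _].
  have in' : (0 < i <= n)%N by nat_lia.
  have Ti : Theta (th i) by apply: iterate_in; nat_lia.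
  have := subgradient_increment (k_sub in' Ti) (Theta_NTheta Tt).
  have := mirror_step_regret nrm_norm Theta_convex Theta_NTheta psi_diff psi_convex
    (eta_gt0 _) Ti (th_step in') Tt.
  move=> /(_ ltac:(nat_lia)); rewrite !innerBr; lra.
rewrite big_split/=; apply: lerD.
  apply: le_trans (weighted_telescope (C := Rad ^+ 2 / 2) _ eta_gt0 eta_noninc _) _ => //.
    move=> i iN; have Ti : Theta (th i) by apply: iterate_in; nat_lia.
    rewrite Rad_bound// andbT.
    apply: le_trans (bregman_ge Theta_NTheta psi_diff psi_convex Tt Ti).
    by rewrite divr_ge0 ?sqr_ge0.
  rewrite (_ : m.+1 + (n - m.+1) = n)%N; last by nat_lia.
  have en := eta_gt0 n_gt0.
  rewrite (_ : Rad ^+ 2 / (2 * eta n) = Rad ^+ 2 / 2 / eta n); last first.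
    by field; rewrite gt_eqF.
  rewrite ler_wpM2r ?invr_ge0 ?(ltW en)// gerBl.
  have Tn : Theta (th (m.+1 + (n - m.+1).+1)%N) by apply: iterate_in; nat_lia.
  apply: le_trans (bregman_ge Theta_NTheta psi_diff psi_convex Tt Tn).
  by rewrite divr_ge0 ?sqr_ge0.
rewrite (_ : m.+1 + (n - m.+1).+1 = n.+1)%N; last by nat_lia.
rewrite [leRHS](big_cat_nat _ (n := m.+1))//=; last by nat_lia.
rewrite lerDr big_nat_cond; apply: sumr_ge0 => i /andP[/andP[i0 _] _]; exact: pos.
Qed.

(** The delayed iterate is first replaced by the current one; by the drift bound
    the cost is a sum of products [eta j * D * dn j], each split by the
    inequality between arithmetic and geometric means so that only second
    moments remain. *)
Lemma delayed_regret_le m t : Theta t ->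
  \sum_(1 <= i < (n - m).+1) (h (i + m) (th i) - h (i + m) t) <=
  \sum_(1 <= i < (n - m).+1) \sum_(i <= j < i + m)
    eta j / 2 * (dual_norm nrm (k (i + m) (th i)) ^+ 2 + dn j ^+ 2)
  + (Rad ^+ 2 / (2 * eta n) + \sum_(1 <= i < n.+1) eta i / 2 * dn i ^+ 2).
Proof.
move=> Tt; apply: le_trans (lerD (lexx _) (regret_le m Tt)).
rewrite -big_split/= big_nat_cond [leRHS]big_nat_cond.
apply: ler_sum => i /andP[/andP[i0 iN] _].
have imn : (0 < i + m <= n)%N by nat_lia.
have Ti : Theta (th i) by apply: iterate_in; nat_lia.
have Tim : Theta (th (i + m)%N) by apply: iterate_in; nat_lia.
have := subgradient_increment (k_sub imn Ti) (Theta_NTheta Tim).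
have := inner_le_dual_norm nrm_norm (k (i + m) (th i)) (th i - th (i + m)%N).
have := ler_wpM2l (dual_norm_ge0 nrm_norm (k (i + m) (th i)))
  (iterate_drift i0 (m := m) ltac:(nat_lia)).
set D := dual_norm nrm (k (i + m)%N (th i)).
have : D * (\sum_(i <= j < i + m) eta j * dn j) <=
    \sum_(i <= j < i + m) eta j / 2 * (D ^+ 2 + dn j ^+ 2).
  rewrite mulr_sumr big_nat_cond [leRHS]big_nat_cond.
  apply: ler_sum => j /andP[/andP[ij _] _].
  have := eta_gt0 (leq_trans i0 ij); move: (dn j) => e ej0.
  have := mulr_ge0 (ltW ej0) (sqr_ge0 (D - e)); lra.
rewrite !innerBr; lra.
Qed.

End mirror_descent.

(** * Comparing a conditional law with the invariant law *)

Lemma integral_probability_cst {d} {T : measurableType d} {R : realType}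
    (P : probability T R) (r : R) : (\int[P]_x r%:E = r%:E)%E.
Proof.
rewrite -[LHS]/(\int[P]_x cst r%:E x)%E integral_cst// -[RHS]mule1.
by congr (_ * _)%E; exact: probability_setT.
Qed.

Section transport.
Context {d1 d2 dO : measure_display} {T1 : measurableType d1}
  {T2 : measurableType d2} {Omega : measurableType dO} {R : realType}.
Context (P : probability Omega R) (Q : probability T2 R) (X : Omega -> T1).
Hypothesis mX : measurable_fun setT X.
Local Open Scope ereal_scope.

(** [kap] is only required to reproduce the joint law of [X] and [Y]: this is what
    a conditional distribution of [Y] gives for every [X] determined by the
    conditioning information. *)
Definition cond_law_along (Y : Omega -> T2) (kap : Omega -> probability T2 R) :=
  [/\ measurable_fun setT Y,
      (forall B, measurable B -> measurable_fun setT (fun w => kap w B)) &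
      (forall A B, measurable A -> measurable B ->
        P (X @^-1` A `&` Y @^-1` B) = \int[P]_(w in X @^-1` A) kap w B)].

Lemma measurable_space_average (phi : T1 * T2 -> \bar R) :
  (forall z, 0 <= phi z) -> measurable_fun setT phi ->
  measurable_fun setT (fun w => \int[Q]_x phi (X w, x)).
Proof.
by move=> phi0 mphi; apply: (@measurable_cond_integral _ _ _ _ _ _ _ (fun=> Q)).
Qed.

(** [hellinger_transport] at each sample point, integrated; the integrals against
    [kap w] become expectations over the pair [(X, Y)] by disintegration. *)
Lemma expected_transport (Y : Omega -> T2) (kap : Omega -> probability T2 R)
    (phi : T1 * T2 -> R) (lam e2 : R) :
  cond_law_along Y kap -> measurable_fun setT phi -> (0 < lam)%R ->
  'E_P[fun w => (hellinger (kap w) Q ^+ 2)%R] <= e2%:E ->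
  \int[P]_w \int[Q]_x (phi^\+ (X w, x))%:E + \int[P]_w (phi^\- (X w, Y w))%:E <=
  \int[P]_w (phi^\+ (X w, Y w))%:E + \int[P]_w \int[Q]_x (phi^\- (X w, x))%:E
  + lam%:E * (\int[P]_w (phi (X w, Y w) ^+ 2)%:E + \int[P]_w \int[Q]_x (phi (X w, x) ^+ 2)%:E)
  + (e2 / (2 * lam))%:E.
Proof.
move=> [mY mkap rect] mphi lam0 hel.
have dis (a : T1 * T2 -> R) : (forall z, 0 <= a z)%R -> measurable_fun setT a ->
   \int[P]_w (a (X w, Y w))%:E = \int[P]_w \int[kap w]_x (a (X w, x))%:E.
  move=> a0 ma; apply: (@disintegration _ _ _ _ _ _ _ _ _ _ _ mkap mX mY rect (EFin \o a)) => //.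
  exact/measurable_EFinP.
have mk (a : T1 * T2 -> R) : (forall z, 0 <= a z)%R -> measurable_fun setT a ->
    measurable_fun setT (fun w => \int[kap w]_x (a (X w, x))%:E).
  move=> a0 ma; apply: (@measurable_cond_integral _ _ _ _ _ _ _ _ _ mkap mX (EFin \o a)).
  - by move=> z; rewrite /= lee_fin.
  - exact/measurable_EFinP.
have mQ (a : T1 * T2 -> R) : (forall z, 0 <= a z)%R -> measurable_fun setT a ->
    measurable_fun setT (fun w => \int[Q]_x (a (X w, x))%:E).
  move=> a0 ma; apply: (measurable_space_average (phi := EFin \o a)).
  - by move=> z; rewrite /= lee_fin.
  - exact/measurable_EFinP.
have Q0 (a : T1 * T2 -> R) w : (forall z, 0 <= a z)%R -> 0 <= \int[Q]_x (a (X w, x))%:E.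
  by move=> a0; apply: integral_ge0 => x _; rewrite lee_fin.
have k0 (a : T1 * T2 -> R) w : (forall z, 0 <= a z)%R -> 0 <= \int[kap w]_x (a (X w, x))%:E.
  by move=> a0; apply: integral_ge0 => x _; rewrite lee_fin.
have gp z : (0 <= phi^\+ z)%R by exact: funrpos_ge0.
have gn z : (0 <= phi^\- z)%R by exact: funrneg_ge0.
pose phi2 z := (phi z ^+ 2)%R.
have g2 z : (0 <= phi2 z)%R by exact: sqr_ge0.
have mgp : measurable_fun setT (phi^\+)%R by exact: measurable_funrpos.
have mgn : measurable_fun setT (phi^\-)%R by exact: measurable_funrneg.
have mg2 : measurable_fun setT phi2 by exact: measurable_funX.
have -> : \int[P]_w \int[Q]_x (phi (X w, x) ^+ 2)%:E =
  \int[P]_w \int[Q]_x (phi2 (X w, x))%:E by [].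
rewrite (dis (phi^\+)%R)// (dis (phi^\-)%R)// (dis phi2)//.
rewrite -ge0_integralD//; [|by move=> w _; exact: Q0|exact: mQ|by move=> w _; exact: k0|exact: mk].
set h := fun w => (hellinger (kap w) Q ^+ 2)%R.
have il0 : (0 < (2 * lam)^-1)%R by rewrite invr_gt0 mulr_gt0.
have hle : (2 * lam)^-1%:E * \int[P]_w (h w)%:E <= (e2 / (2 * lam))%:E.
  have -> : (e2 / (2 * lam))%:E = (2 * lam)^-1%:E * e2%:E by rewrite -EFinM mulrC.
  by apply: lee_wpmul2l; [rewrite lee_fin ltW|move: hel; rewrite unlock].
apply: le_trans (leeD (lexx _) hle).
rewrite -[X in _ <= X + _ + _]ge0_integralD//;
  [|by move=> w _; exact: k0|exact: mk|by move=> w _; exact: Q0|exact: mQ].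
rewrite -[X in _ <= _ + _ * X + _]ge0_integralD//;
  [|by move=> w _; exact: k0|exact: mk|by move=> w _; exact: Q0|exact: mQ].
rewrite -ge0_integralZl_EFin//;
  [|by move=> w _; apply: adde_ge0; [exact: k0|exact: Q0]
   |by apply: emeasurable_funD; [exact: mk|exact: mQ]|exact: ltW].
have m1 : measurable_fun setT (fun w => \int[kap w]_x (phi^\+ (X w, x))%:E +
    \int[Q]_x (phi^\- (X w, x))%:E).
  by apply: emeasurable_funD; [exact: mk|exact: mQ].
have m2 : measurable_fun setT (fun w =>
    lam%:E * (\int[kap w]_x (phi2 (X w, x))%:E + \int[Q]_x (phi2 (X w, x))%:E)).
  by apply: measurable_funeM; apply: emeasurable_funD; [exact: mk|exact: mQ].
have p1 w : 0 <= \int[kap w]_x (phi^\+ (X w, x))%:E + \int[Q]_x (phi^\- (X w, x))%:E.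
  by apply: adde_ge0; [exact: k0|exact: Q0].
have p2 w : 0 <= lam%:E * (\int[kap w]_x (phi2 (X w, x))%:E + \int[Q]_x (phi2 (X w, x))%:E).
  by apply: mule_ge0; [rewrite lee_fin ltW|apply: adde_ge0; [exact: k0|exact: Q0]].
rewrite -ge0_integralD//.
apply: le_integralD_nonmeasurable.
- by move=> w; apply: adde_ge0; [exact: Q0|exact: k0].
- by move=> w; exact: adde_ge0.
- by move=> w; exact: sqr_ge0.
- by [].
- by apply: emeasurable_funD; [exact: mQ|exact: mk].
- exact: emeasurable_funD.
- move=> w.
  have mw : measurable_fun setT (fun x => phi (X w, x)) by exact: measurableT_comp.
  by have := hellinger_transport (kap w) Q mw lam0; rewrite (mulrC _ (2 * lam)^-1%R).
Qed.


(** For a truncation of [phi] at level [n] the second moments are at most [n^2],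
    so the comparison of laws costs [2 lam n^2 + dl^2 / (2 lam)], which is
    arbitrarily small for small [lam] and then small [dl]. Monotone convergence
    removes the truncation. *)
Lemma stationary_le (phi : T1 * T2 -> R) (c : R) :
  measurable_fun setT phi -> (forall z, 0 <= phi z)%R ->
  (forall dl : R, (0 < dl)%R -> exists Y kap, [/\ cond_law_along Y kap,
     'E_P[fun w => (hellinger (kap w) Q ^+ 2)%R] <= (dl ^+ 2)%:E &
     \int[P]_w (phi (X w, Y w))%:E <= c%:E]) ->
  \int[P]_w \int[Q]_x (phi (X w, x))%:E <= c%:E.
Proof.
move=> mphi phi0 mix.
pose tr (n : nat) z := Num.min (phi z) n%:R.
have tr0 n z : (0 <= tr n z)%R by rewrite le_min phi0/=.
have mtr n : measurable_fun setT (tr n) by exact: measurable_minr.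
have trp n : ((tr n)^\+)%R = tr n.
  by apply/funext => z; rewrite /funrpos max_l.
have trn n : ((tr n)^\-)%R = cst 0%R.
  by apply/funext => z; rewrite /funrneg max_r// oppr_le0.
have mtrw n w : measurable_fun setT (fun x => tr n (X w, x)) by exact: measurableT_comp.
have tr_le n : \int[P]_w \int[Q]_x (tr n (X w, x))%:E <= c%:E.
  apply/lee_addgt0Pr => e e0.
  (* lam makes [2 lam n^2 <= e / 2], and [dl^2 = lam e] makes the other error
     [dl^2 / (2 lam)] equal to [e / 2] *)
  pose lam : R := (e / (4 * (n%:R ^+ 2 + 1)))%R.
  have n20 : (0 < n%:R ^+ 2 + 1 :> R)%R by rewrite ltr_wpDl// sqr_ge0.
  have lam0 : (0 < lam)%R by rewrite divr_gt0// mulr_gt0.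
  pose dl := Num.sqrt (lam * e)%R.
  have dl0 : (0 < dl)%R by rewrite sqrtr_gt0 mulr_gt0.
  have [Y [kap [law hel EY]]] := mix dl dl0.
  have := expected_transport law (mtr n) lam0 hel.
  rewrite trp trn /=.
  rewrite [X in _ + X <= _](_ : _ = 0); last by rewrite integral0_eq.
  rewrite [X in _ <= _ + X + _ + _](_ : _ = 0); last first.
    by rewrite integral0_eq// => w _; rewrite integral0_eq.
  rewrite !adde0 => /le_trans; apply.
  have sq z : (tr n z ^+ 2 <= n%:R ^+ 2)%R.
    by rewrite ler_sqr ?nnegrE// ge_min lexx orbT.
  have I1 : \int[P]_w (tr n (X w, Y w) ^+ 2)%:E <= (n%:R ^+ 2)%:E.
    apply: (@le_trans _ _ (\int[P]_w (n%:R ^+ 2)%:E)).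
      by apply: le_integral_nonmeasurable => w; rewrite lee_fin ?sqr_ge0.
      by rewrite integral_probability_cst.
  have I2 : \int[P]_w \int[Q]_x (tr n (X w, x) ^+ 2)%:E <= (n%:R ^+ 2)%:E.
    apply: (@le_trans _ _ (\int[P]_w (n%:R ^+ 2)%:E)).
      apply: le_integral_nonmeasurable => w.
        by apply: integral_ge0 => x _; rewrite lee_fin sqr_ge0.
      apply: (@le_trans _ _ (\int[Q]_x (n%:R ^+ 2)%:E)).
        apply: le_integral_nonmeasurable => x; rewrite lee_fin ?sqr_ge0//.
      by rewrite integral_probability_cst.
      by rewrite integral_probability_cst.
  apply: (@le_trans _ _ (c%:E + lam%:E * ((n%:R ^+ 2)%:E + (n%:R ^+ 2)%:E) + (dl ^+ 2 / (2 * lam))%:E)).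
    apply: leeD => //; apply: leeD.
      apply: le_trans EY; apply: le_integral_nonmeasurable => w; rewrite lee_fin//.
      by rewrite ge_min lexx.
    by apply: lee_wpmul2l; [rewrite lee_fin ltW|exact: leeD].
  rewrite -[X in X <= _]/((c + lam * (n%:R ^+ 2 + n%:R ^+ 2) + dl ^+ 2 / (2 * lam))%R%:E).
  rewrite -EFinD lee_fin -addrA lerD2l.
  rewrite sqr_sqrtr ?mulr_ge0 ?ltW//.
  have -> : (lam * e / (2 * lam) = e / 2)%R by field; rewrite gt_eqF.
  rewrite /lam.
  have -> : (e / (4 * (n%:R ^+ 2 + 1)) * (n%:R ^+ 2 + n%:R ^+ 2) =
     e / 2 - e / 2 / (n%:R ^+ 2 + 1))%R by field; rewrite gt_eqF.
  have : (0 < e / 2 / (n%:R ^+ 2 + 1))%R by rewrite !divr_gt0.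
  lra.
have trcvg z : (tr n z)%:E @[n --> \oo] --> (phi z)%:E.
  apply: cvg_near_cst.
  exists (Num.truncn (phi z)).+1 => // n /= zn; congr _%:E.
  apply/min_idPl; apply: (@le_trans _ _ (Num.truncn (phi z)).+1%:R).
    by rewrite ltW// truncnS_gt.
  by rewrite ler_nat.
have trnd z n m : (n <= m)%N -> (tr n z <= tr m z)%R.
  by move=> nm; rewrite le_min ge_min lexx /= ge_min ler_nat nm orbT.
have inner w : \int[Q]_x (phi (X w, x))%:E = limn (fun n => \int[Q]_x (tr n (X w, x))%:E).
  rewrite -monotone_convergence//.
  - by apply: eq_integral => x _; apply/esym/cvg_lim => //; exact: trcvg.
  - by move=> n; exact/measurable_EFinP.
  - by move=> n x _; rewrite lee_fin.
  - by move=> x _ n m nm; rewrite lee_fin trnd.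
have mQ n : measurable_fun setT (fun w => \int[Q]_x (tr n (X w, x))%:E).
  apply: (measurable_space_average (phi := EFin \o tr n)).
  - by move=> z; rewrite /= lee_fin.
  - exact/measurable_EFinP.
have Q0 n w : 0 <= \int[Q]_x (tr n (X w, x))%:E.
  by apply: integral_ge0 => x _; rewrite lee_fin.
have Qnd w n m : (n <= m)%N -> \int[Q]_x (tr n (X w, x))%:E <= \int[Q]_x (tr m (X w, x))%:E.
  by move=> nm; apply: le_integral_nonmeasurable => x; rewrite lee_fin// trnd.
rewrite (eq_integral (fun w => limn (fun n => \int[Q]_x (tr n (X w, x))%:E))); last first.
  by move=> w _; exact: inner.
rewrite monotone_convergence//; last first.
  by move=> w _ n m nm; exact: Qnd.
apply: lime_le; last exact: nearW.
apply: ereal_nondecreasing_is_cvgn => n m nm.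
by apply: le_integral_nonmeasurable => w //; exact: Qnd.
Qed.

(** The bound of [expected_transport] is [2 lam c + eps^2 / (2 lam)], which is
    smallest for [lam = eps / (2 sqrt c)]. The second moments also make all
    integrals finite, so the positive and negative parts can be recombined. *)
Lemma mixing_gap (Y : Omega -> T2) (kap : Omega -> probability T2 R)
    (phi : T1 * T2 -> R) (eps c : R) :
  measurable_fun setT phi -> (0 < eps)%R -> (0 < c)%R ->
  cond_law_along Y kap ->
  'E_P[fun w => (hellinger (kap w) Q ^+ 2)%R] <= (eps ^+ 2)%:E ->
  \int[P]_w (phi (X w, Y w) ^+ 2)%:E <= c%:E ->
  \int[P]_w \int[Q]_x (phi (X w, x) ^+ 2)%:E <= c%:E ->
  (forall w, Q.-integrable setT (fun x => (phi (X w, x))%:E)) ->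
  [/\ P.-integrable setT (fun w => (\int[Q]_x phi (X w, x))%R%:E),
      P.-integrable setT (fun w => (phi (X w, Y w))%:E) &
      \int[P]_w (\int[Q]_x phi (X w, x))%R%:E <=
      \int[P]_w (phi (X w, Y w))%:E + (2 * eps * Num.sqrt c)%:E].
Proof.
move=> mphi eps0 c0 law hel EY EQ intQ.
have [mY _ _] := law.
have mXY : measurable_fun setT (fun w => (X w, Y w)) by exact: measurable_fun_pair.
pose u := (phi^\+)%R; pose v := (phi^\-)%R.
have u0 z : (0 <= u z)%R by exact: funrpos_ge0.
have v0 z : (0 <= v z)%R by exact: funrneg_ge0.
have uv z : phi z = (u z - v z)%R by rewrite -[in LHS](funrposBneg phi).
have mu : measurable_fun setT u by exact: measurable_funrpos.
have mv : measurable_fun setT v by exact: measurable_funrneg.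
have u2 z : (u z <= 1 + phi z ^+ 2)%R.
  by rewrite /u /funrpos ge_max; apply/andP; split; nra.
have v2 z : (v z <= 1 + phi z ^+ 2)%R.
  by rewrite /v /funrneg ge_max; apply/andP; split; nra.
have sq_int : measurable_fun setT (fun z => phi z ^+ 2)%R by exact: measurable_funX.
have mQ (a : T1 * T2 -> R) : (forall z, 0 <= a z)%R -> measurable_fun setT a ->
    measurable_fun setT (fun w => \int[Q]_x (a (X w, x))%:E).
  move=> a0 ma; apply: (measurable_space_average (phi := EFin \o a)).
  - by move=> z; rewrite /= lee_fin.
  - exact/measurable_EFinP.
have Q0 (a : T1 * T2 -> R) w : (forall z, 0 <= a z)%R -> 0 <= \int[Q]_x (a (X w, x))%:E.
  by move=> a0; apply: integral_ge0 => x _; rewrite lee_fin.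
have finY (a : T1 * T2 -> R) : (forall z, 0 <= a z <= 1 + phi z ^+ 2)%R ->
    \int[P]_w (a (X w, Y w))%:E < +oo.
  move=> ha; apply: (@le_lt_trans _ _ (\int[P]_w (1 + phi (X w, Y w) ^+ 2)%:E)).
    by apply: le_integral_nonmeasurable => w; rewrite lee_fin; case/andP: (ha (X w, Y w)).
  under eq_integral do rewrite EFinD.
  rewrite ge0_integralD//; last 2 first.
  - by move=> w _; rewrite lee_fin sqr_ge0.
  - by apply/measurable_EFinP/(measurableT_comp sq_int mXY).
  by rewrite integral_probability_cst lte_add_pinfty ?ltry// (le_lt_trans EY)// ltry.
have finQ (a : T1 * T2 -> R) : (forall z, 0 <= a z <= 1 + phi z ^+ 2)%R ->
    \int[P]_w \int[Q]_x (a (X w, x))%:E < +oo.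
  move=> ha.
  apply: (@le_lt_trans _ _ (\int[P]_w (1 + \int[Q]_x (phi (X w, x) ^+ 2)%:E))).
    apply: le_integral_nonmeasurable => w.
      by apply: Q0 => z; case/andP: (ha z).
    apply: (@le_trans _ _ (\int[Q]_x (1 + phi (X w, x) ^+ 2)%:E)).
      by apply: le_integral_nonmeasurable => x; rewrite lee_fin; case/andP: (ha (X w, x)).
    under eq_integral do rewrite EFinD.
    rewrite ge0_integralD//.
    - by rewrite integral_probability_cst.
    - by move=> x _; rewrite lee_fin sqr_ge0.
    - by apply/measurable_EFinP/(measurableT_comp sq_int); exact: pair1_measurable.
  rewrite ge0_integralD//; last 2 first.
  - by move=> w _; apply: (Q0 (fun z => phi z ^+ 2)%R) => z; exact: sqr_ge0.
  - by apply: (mQ (fun z => phi z ^+ 2)%R) => // z; exact: sqr_ge0.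
  by rewrite integral_probability_cst lte_add_pinfty ?ltry// (le_lt_trans EQ)// ltry.
have uB z : (0 <= u z <= 1 + phi z ^+ 2)%R by rewrite u0 u2.
have vB z : (0 <= v z <= 1 + phi z ^+ 2)%R by rewrite v0 v2.
have iY (a : T1 * T2 -> R) : measurable_fun setT a ->
    (forall z, 0 <= a z <= 1 + phi z ^+ 2)%R ->
    P.-integrable setT (fun w => (a (X w, Y w))%:E).
  move=> ma ha; apply/integrableP; split.
    by apply/measurable_EFinP/(measurableT_comp ma mXY).
  under eq_integral do rewrite gee0_abs ?lee_fin ?(andP (ha _)).1//.
  exact: finY.
have iQ (a : T1 * T2 -> R) : measurable_fun setT a ->
    (forall z, 0 <= a z <= 1 + phi z ^+ 2)%R ->
    P.-integrable setT (fun w => \int[Q]_x (a (X w, x))%:E).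
  move=> ma ha; have a0 z : (0 <= a z)%R by case/andP: (ha z).
  apply/integrableP; split; first exact: mQ.
  under eq_integral do rewrite gee0_abs ?Q0//.
  exact: finQ.
have QE w : (\int[Q]_x phi (X w, x))%R%:E =
    \int[Q]_x (u (X w, x))%:E - \int[Q]_x (v (X w, x))%:E.
  rewrite /Rintegral fineK; last exact: integrable_fin_num.
  rewrite integralE; congr (_ - _); apply: eq_integral => x _.
    by rewrite funeposE /u /funrpos EFin_max.
  by rewrite funenegE /v /funrneg EFin_max.
have YE w : (phi (X w, Y w))%:E = (u (X w, Y w))%:E - (v (X w, Y w))%:E.
  by rewrite -EFinB uv.
split.
- rewrite (funext QE); exact: integrableB (iQ u mu uB) (iQ v mv vB).
- rewrite (funext YE); exact: integrableB (iY u mu uB) (iY v mv vB).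
rewrite (funext QE) (funext YE).
rewrite (integralB measurableT (iQ u mu uB) (iQ v mv vB)).
rewrite (integralB measurableT (iY u mu uB) (iY v mv vB)).
pose lam := (eps / (2 * Num.sqrt c))%R.
have sc0 : (0 < Num.sqrt c)%R by rewrite sqrtr_gt0.
have lam0 : (0 < lam)%R by rewrite divr_gt0// mulr_gt0.
have := expected_transport law mphi lam0 hel; rewrite -/u -/v.
have S2 : lam%:E * (\int[P]_w (phi (X w, Y w) ^+ 2)%:E +
    \int[P]_w \int[Q]_x (phi (X w, x) ^+ 2)%:E) <= (lam * (c + c))%:E.
  rewrite -[X in _ <= X]/(lam%:E * (c%:E + c%:E)).
  by apply: lee_wpmul2l; [rewrite lee_fin ltW|exact: leeD].
move=> /le_trans /(_ (leeD (leeD (lexx _) S2) (lexx _))).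
move: (integrable_fin_num measurableT (iQ u mu uB)) (integrable_fin_num measurableT (iQ v mv vB)).
move: (integrable_fin_num measurableT (iY u mu uB)) (integrable_fin_num measurableT (iY v mv vB)).
move: (\int[P]_w \int[Q]_x (u (X w, x))%:E) (\int[P]_w \int[Q]_x (v (X w, x))%:E).
move: (\int[P]_w (u (X w, Y w))%:E) (\int[P]_w (v (X w, Y w))%:E).
move=> [a||]// [b||]// [a'||]// [b'||]// _ _ _ _.
rewrite -!EFinD !lee_fin.
have -> : (lam * (c + c) = eps * Num.sqrt c)%R.
  rewrite /lam; have := sqr_sqrtr (ltW c0); move: (Num.sqrt c) sc0 => s s0 <-.
  by field; exact: lt0r_neq0.
have -> : (eps ^+ 2 / (2 * lam) = eps * Num.sqrt c)%R.
  by rewrite /lam; field; rewrite !lt0r_neq0.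
lra.
Qed.

End transport.

(** * Bounds on means, information and mixing lags *)

Lemma integral_le_ge0 {d} {T : measurableType d} {R : realType}
    (mu : {measure set T -> \bar R}) (f g : T -> \bar R) :
  (forall x, f x <= g x)%E -> (forall x, 0 <= g x)%E ->
  (\int[mu]_x f x <= \int[mu]_x g x)%E.
Proof.
move=> fg g0; rewrite integralE.
apply: (@le_trans _ _ (\int[mu]_x f^\+ x)%E).
  rewrite -[leRHS]sube0; apply: leeB => //.
  by apply: integral_ge0 => x _; exact: funeneg_ge0.
apply: le_integral_nonmeasurable => x; first exact: funepos_ge0.
by rewrite funeposE ge_max fg g0.
Qed.

Section mean_le.
Context {d : measure_display} {T : measurableType d} {R : realType}.
Context (P : probability T R).
Implicit Types (f g : T -> R) (a b c : R).

(** Integrability is part of the definition so that such bounds can be added and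
    scaled. *)
Definition mean_le f c : Prop :=
  P.-integrable setT (EFin \o f) /\ (\int[P]_w (f w)%:E <= c%:E)%E.

Lemma mean_le_cst c : mean_le (cst c) c.
Proof.
split; last by rewrite integral_probability_cst.
exact: finite_measure_integrable_cst.
Qed.

Lemma mean_leD f g a b : mean_le f a -> mean_le g b ->
  mean_le (fun w => f w + g w) (a + b).
Proof.
move=> [fi fa] [gi gb]; split; first exact: integrableD fi gi.
rewrite (integralD_EFin measurableT fi gi) EFinD; exact: leeD.
Qed.

Lemma mean_leZ f a c : 0 <= c -> mean_le f a -> mean_le (fun w => c * f w) (c * a).
Proof.
move=> c0 [fi fa]; split; first exact: (integrableZl measurableT c fi).
under eq_integral do rewrite EFinM.
by rewrite (integralZl measurableT fi) EFinM; apply: lee_wpmul2l.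
Qed.

Lemma mean_le_sum (F : nat -> T -> R) (c : nat -> R) (k n : nat) :
  (forall i, (k <= i < n)%N -> mean_le (F i) (c i)) ->
  mean_le (fun w => \sum_(k <= i < n) F i w) (\sum_(k <= i < n) c i).
Proof.
elim: n => [|n IH] Fc.
  rewrite big_geq// (_ : (fun w => _) = cst 0); first exact: mean_le_cst.
  by apply/funext => w; rewrite big_geq.
have [nk|kn] := ltnP n k.
  rewrite big_geq// (_ : (fun w => _) = cst 0); first exact: mean_le_cst.
  by apply/funext => w; rewrite big_geq.
rewrite big_nat_recr//= (_ : (fun w => _) =
    (fun w => \sum_(k <= i < n) F i w + F n w)); last first.
  by apply/funext => w; rewrite big_nat_recr.
apply: mean_leD; last by apply: Fc; nat_lia.
by apply: IH => i ain; apply: Fc; nat_lia.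
Qed.

Lemma integrable_mean_le f : P.-integrable setT (EFin \o f) ->
  mean_le f (fine (\int[P]_w (f w)%:E)).
Proof. by move=> fi; split => //; rewrite fineK// (integrable_fin_num measurableT fi). Qed.

Lemma integrable_sum_nat (F : nat -> T -> R) (k n : nat) :
  (forall i, (k <= i < n)%N -> P.-integrable setT (EFin \o F i)) ->
  P.-integrable setT (EFin \o (fun w => \sum_(k <= i < n) F i w)).
Proof. by move=> Fi; have [] := mean_le_sum (fun i ki => integrable_mean_le (Fi i ki)). Qed.

Lemma mean_le_ge0 f c : measurable_fun setT f -> (forall w, 0 <= f w) ->
  (\int[P]_w (f w)%:E <= c%:E)%E -> mean_le f c.
Proof.
move=> mf f0 fc; split => //; apply/integrableP; split; first exact/measurable_EFinP.
under eq_integral do rewrite /= ger0_norm//.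
exact: le_lt_trans fc (ltry _).
Qed.

Lemma mean_le_dominated f g c : P.-integrable setT (EFin \o f) ->
  (forall w, f w <= g w) -> (forall w, 0 <= g w) -> mean_le g c -> mean_le f c.
Proof.
move=> fi fg g0 [_ gc]; split => //; apply: le_trans gc.
by apply: integral_le_ge0 => w; rewrite lee_fin.
Qed.

Lemma integrable_of_sqr f c : measurable_fun setT f ->
  mean_le (fun w => f w ^+ 2) c -> P.-integrable setT (EFin \o f).
Proof.
move=> mf f2c; have [h _] := mean_leD (mean_le_cst 1) f2c.
apply: (@le_integrable _ _ _ P setT measurableT _ (EFin \o (fun w => 1 + f w ^+ 2))).
- exact/measurable_EFinP.
- move=> w _; rewrite lee_fin/= [leRHS]ger0_norm ?addr_ge0 ?sqr_ge0//.
  by rewrite ler_norml; apply/andP; split; nra.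
- exact: h.
Qed.

End mean_le.

Section information.
Context {d : measure_display} {T : measurableType d} {R : realType}.
Context (P : probability T R).

Lemma sub_measurable_mono {k} (GG GG' : set (set T)) (X : T -> 'rV[R]_k) :
  GG `<=` GG' -> sub_measurable GG X -> sub_measurable GG' X.
Proof. by move=> sub XG; exact: subset_trans XG sub. Qed.

Lemma sub_measurable_fun {k} (GG : set (set T)) (X : T -> 'rV[R]_k) :
  sub_sigma_algebra_of GG -> sub_measurable GG X ->
  measurable_fun setT (X : T -> borel R k).
Proof. by move=> [_ GGm] XG _ B mB; apply/GGm/XG; exists B. Qed.

Lemma sub_measurable_cst {k} (GG : set (set T)) (t : 'rV[R]_k) :
  sub_sigma_algebra_of GG -> sub_measurable GG (fun=> t).
Proof.
move=> [[G0 GC _] _] _ [B mB <-]; rewrite setTI preimage_cst.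
by case: ifP => // _; rewrite -(setD0 setT); exact: GC.
Qed.

Lemma sub_measurable_generated {k} (J : set nat) (X : nat -> T -> 'rV[R]_k) j
    (GG : set (set T)) :
  J j -> sigma_generated J X `<=` GG -> sub_measurable GG (X j).
Proof.
move=> Jj XG; apply: subset_trans XG; apply: subset_trans (@sub_sigma_algebra _ _ _).
by move=> A XA; exists j.
Qed.

Lemma cond_law_of_cond_distribution {k l} (GG : set (set T))
    (X : T -> 'rV[R]_k) (Y : T -> 'rV[R]_l) (kap : T -> probability (borel R l) R) :
  sub_sigma_algebra_of GG -> sub_measurable GG X ->
  measurable_fun setT (Y : T -> borel R l) ->
  is_cond_distribution P GG Y kap ->
  cond_law_along P (X : T -> borel R k) (Y : T -> borel R l) kap.
Proof.
move=> [sG GGm] XG mY kapY; split => //.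
- move=> B /kapY[mk _] _ A mA.
  have h : <<s GG>> (setT `&` (fun w => kap w B) @^-1` A) := mk measurableT A mA.
  by apply: GGm; rewrite -(sigma_algebra_id sG).
- move=> A B mA /kapY[_]; apply; apply: XG; exists A => //.
  by rewrite setTI.
Qed.

(** The mixing time is an infimum of natural numbers, hence attained when it is
    finite. *)
Lemma mixing_lagP {l} (Pi : probability (borel R l) R)
    (kap : nat -> nat -> T -> probability (borel R l) R) (eps : R) :
  (mixing_time P Pi kap eps < +oo)%E ->
  mixing_set P Pi kap eps (mixing_lag P Pi kap eps).
Proof.
rewrite /mixing_lag /mixing_time; set S := mixing_set P Pi kap eps => fin.
have exS : exists k, `[< S k >].
  apply: contrapT => noS; move: fin; rewrite (_ : S = set0) ?image_set0 ?ereal_inf0//.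
  by apply/seteqP; split => // k Sk; apply: noS; exists k; apply/asboolP.
case: (ex_minnP exS) => k /asboolP Sk kmin.
rewrite (_ : ereal_inf _ = (k%:R)%:E) /= ?natrK//.
apply/eqP; rewrite eq_le; apply/andP; split; first by apply: ereal_inf_lbound; exists k.
apply: le_ereal_inf_tmp => _ [j Sj <-].
by rewrite lee_fin ler_nat; apply: kmin; apply/asboolP.
Qed.

Lemma mixing_set_le {l} (Pi : probability (borel R l) R)
    (kap : nat -> nat -> T -> probability (borel R l) R) (eps : R) tau i :
  mixing_set P Pi kap eps tau ->
  ('E_P[fun w => (hellinger (kap i (i + tau)%N w) Pi ^+ 2)%R] <= (eps ^+ 2)%:E)%E.
Proof. by move=> [_]; apply: le_trans; apply: ereal_sup_ubound; exists i. Qed.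

End information.

(** * Measurability of differences of convex functions *)

Lemma measurable_segment {d} {T : measurableType d} {R : realType} {p : nat}
    (D : set T) (X : T -> 'rV[R]_p) (s t : 'rV[R]_p) (c : R) :
  measurable_fun D (X : T -> borel R p) ->
  measurable_fun D ((fun w => c *: (X w - t) + s) : T -> borel R p).
Proof.
move=> mX; have mseg : measurable_fun setT
    ((fun y : 'rV[R]_p => c *: (y - t) + s) : borel R p -> borel R p).
  apply: continuous_borel => y.
  apply: (@cvgD _ _ _ (nbhs y)); last exact: (@cvg_cst _ _ _ (nbhs y)).
  apply: (@cvgZr _ _ _ (nbhs y)).
  by apply: (@cvgB _ _ _ (nbhs y)); [exact: cvg_id|exact: (@cvg_cst _ _ _ (nbhs y))].
exact: measurableT_comp mseg mX.
Qed.

(** Pointwise limit of the Riemann sums of the subgradients, which are measurable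
    because [g] is along each point of the segment. *)
Lemma measurable_subgradient_gap {d} {T : measurableType d} {R : realType} {p : nat}
    (D : set T) (A N : set 'rV[R]_p) (X : T -> 'rV[R]_p) (t : 'rV[R]_p)
    (f : T -> 'rV[R]_p -> R) (g : T -> 'rV[R]_p -> 'rV[R]_p) :
  convex_set A -> A `<=` N -> A t -> (forall w, D w -> A (X w)) ->
  (forall w, D w -> forall s, A s -> subdifferential N (f w) s (g w s)) ->
  measurable_fun D (X : T -> borel R p) ->
  (forall c, 0 <= c <= 1 -> measurable_fun D
    ((fun w => g w (c *: (X w - t) + t)) : T -> borel R p)) ->
  measurable_fun D (fun w => f w (X w) - f w t).
Proof.
move=> cA AN At AX gf mX mg.
apply: (@measurable_fun_cvg _ _ _ _
  (fun n w => subgradient_riemann (g w) t (X w) n)) => [n|w Dw]; last first.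
  by apply: (subgradient_riemann_cvg cA AN (gf _ Dw)) => //; exact: AX.
rewrite /subgradient_riemann; apply: measurable_funM; first exact: measurable_cst.
have mX' : measurable_fun D ((fun w => X w - t) : T -> borel R p).
  have := measurable_segment 0 t 1 mX.
  rewrite [X in measurable_fun _ X -> _](_ : _ = (fun w => X w - t))//.
  by apply/funext => w; rewrite scale1r addr0.
have kn k : (k < n.+1)%N -> 0 <= (k%:R / n.+1%:R : R) <= 1.
  by move=> kn; rewrite divr_ge0//= ler_pdivrMr// mul1r ler_nat ltnW.
under eq_fun do rewrite big_mkord.
apply: measurable_sum => k; apply: measurable_inner => //.
exact/mg/kn.
Qed.

Lemma measurable_fun_restrict0 {d} {T : measurableType d} {R : realType}
    (D : set T) (f : T -> R) :
  measurable D -> measurable_fun D f -> measurable_fun setT (f \_ D).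
Proof. by move=> mD mf; apply/measurable_restrict => //; rewrite setTI. Qed.

(** * Losses at sampled states *)

Section sampled_losses.
Context {R : realType} {n d p : nat}.
Context {dO : measure_display} {Omega : measurableType dO} (P : probability Omega R).
Context (Xi : set (borel R d)) (Pi : probability (borel R d) R).
Hypothesis mXi : measurable Xi.
Context (xi : nat -> Omega -> 'rV[R]_d).
Hypothesis xi_Xi : forall i w, (0 < i)%N -> Xi (xi i w).
Context (nrm : 'rV[R]_p -> R).
Hypothesis nrm_norm : is_norm nrm.
Context (Theta NTheta : set 'rV[R]_p).
Hypothesis Theta_closed : closed Theta.
Hypothesis Theta_convex : convex_set Theta.
Hypothesis Theta_NTheta : Theta `<=` NTheta.
Context (Rad : R).
Hypothesis Rad_gt0 : 0 < Rad.
Hypothesis Theta_diam : forall s t, Theta s -> Theta t -> nrm (s - t) <= Rad.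
Context (F : 'rV[R]_p -> 'rV[R]_d -> R).
Hypothesis F_int :
  forall t, NTheta t -> Pi.-integrable Xi (fun x => (F t x)%:E).
Context (G : 'rV[R]_p -> 'rV[R]_d -> 'rV[R]_p).
Hypothesis mG : measurable_fun (Theta `*` Xi : set (borel R p * borel R d))
  (fun z => G z.1 z.2 : borel R p).
Hypothesis G_subdiff : forall t x, Theta t -> Xi x ->
  subdifferential NTheta (fun u => F u x) t (G t x).
Context (FF : nat -> set (set Omega)).
Hypothesis FF_filtration : is_filtration FF.
Hypothesis FF_xi : forall i, sigma_generated [set j | (0 < j <= i)%N] xi `<=` FF i.
Context (kap : nat -> nat -> Omega -> probability (borel R d) R).
Hypothesis kap_cond : forall i j, (i < j)%N ->
  is_cond_distribution P (FF i) (xi j) (kap i j).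
Context (Gc : R).
Hypothesis Gc_gt0 : 0 < Gc.
Hypothesis A1 : forall i (vt : Omega -> 'rV[R]_p), (0 < i)%N ->
  sub_measurable (FF (minn i n).-1) vt -> (forall w, Theta (vt w)) ->
  ('E_P[fun w => (dual_norm nrm (G (vt w) (xi i w)) ^+ 2)%R] <= (Gc ^+ 2)%:E)%E.
Hypothesis A3 : forall eps : R, 0 < eps -> (mixing_time P Pi kap eps < +oo)%E.

Definition sample_domain : set (borel R p * borel R d) := Theta `*` Xi.

(** Extension by [0] outside [sample_domain], where the subgradients are not
    known to be measurable; likewise for [loss_gap]. *)
Definition gradient_sqr : borel R p * borel R d -> R :=
  (fun z => dual_norm nrm (G z.1 z.2) ^+ 2) \_ sample_domain.

Definition loss_gap (t' : 'rV[R]_p) : borel R p * borel R d -> R :=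
  (fun z => F z.1 z.2 - F t' z.2) \_ sample_domain.

Let msample_domain : measurable sample_domain.
Proof. by apply: measurableX => //; exact: closed_borel. Qed.

Lemma gradient_sqr_ge0 z : 0 <= gradient_sqr z.
Proof. by rewrite /gradient_sqr patchE; case: ifP => // _; exact: sqr_ge0. Qed.

Lemma gradient_sqrE t x : Theta t -> Xi x ->
  gradient_sqr (t, x) = dual_norm nrm (G t x) ^+ 2.
Proof. by move=> Tt Xx; rewrite /gradient_sqr patchE mem_set. Qed.

Lemma loss_gapE t' t x : Theta t -> Xi x -> loss_gap t' (t, x) = F t x - F t' x.
Proof. by move=> Tt Xx; rewrite /loss_gap patchE mem_set. Qed.

Lemma measurable_gradient_sqr : measurable_fun setT gradient_sqr.
Proof.
apply: measurable_fun_restrict0 => //; apply: measurable_funX.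
exact: measurableT_comp (measurable_dual_norm nrm_norm) mG.
Qed.

Lemma measurable_loss_gap t' : Theta t' -> measurable_fun setT (loss_gap t').
Proof.
move=> Tt'; apply: measurable_fun_restrict0 => //.
have mfst : measurable_fun sample_domain (fst : borel R p * borel R d -> borel R p).
  by apply: measurable_funS measurable_fst.
apply: (@measurable_subgradient_gap _ _ _ _ sample_domain Theta NTheta
  (fun z => z.1) t' (fun z s => F s z.2) (fun z s => G s z.2)) => //.
- by move=> z [].
- by move=> z [_ Xz] s Ts; exact: G_subdiff.
move=> c c01.
have mseg := @measurable_segment _ _ _ _ setT (fun z : borel R p * borel R d => (z.1 : 'rV[R]_p)) t' t' c
  (@measurable_fst _ _ (borel R p) (borel R d)).
have mpair := measurable_funTS (D := sample_domain) (measurable_fun_pair mseg measurable_snd).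
apply: (measurable_comp msample_domain _ mG mpair).
by move=> _ [z [Tz Xz] <-]; split => //=; exact: convex_set_segment.
Qed.

(** From [2 a <= a^2 / Gc + Gc], with equality for [a = Gc]. *)
Lemma loss_gap_le t' z : Theta t' ->
  loss_gap t' z <= Rad / 2 * (Gc^-1 * gradient_sqr z + Gc).
Proof.
move=> Tt'; rewrite /loss_gap /gradient_sqr !patchE.
case: ifPn => [/set_mem[Tz Xz]|_].
  have := subgradient_gap nrm_norm Theta_NTheta Theta_diam Tz Tt' (G_subdiff Tz Xz).
  move: (dual_norm _ _) => a.
  have : 0 <= Rad / 2 * (Gc^-1 * (a - Gc) ^+ 2).
    by rewrite mulr_ge0 ?divr_ge0 ?(ltW Rad_gt0)// mulr_ge0 ?sqr_ge0// invr_ge0 ltW.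
  rewrite (_ : Gc^-1 * (a - Gc) ^+ 2 = Gc^-1 * a ^+ 2 - 2 * a + Gc); first by lra.
  by field; rewrite gt_eqF.
by rewrite mulr0 add0r mulr_ge0 ?divr_ge0 ?(ltW Rad_gt0)// ltW.
Qed.

Lemma loss_gap_sqr_le t' z : Theta t' ->
  loss_gap t' z ^+ 2 <= Rad ^+ 2 * (gradient_sqr z + gradient_sqr (t', z.2)).
Proof.
move=> Tt'; have := gradient_sqr_ge0 (t', z.2).
rewrite /loss_gap {2}/gradient_sqr !patchE.
case: ifPn => [/set_mem[Tz Xz] _|_ g0].
  rewrite (gradient_sqrE Tt' Xz).
  exact: (subgradient_gap_sqr nrm_norm Theta_NTheta Theta_diam Tz Tt'
    (G_subdiff Tz Xz) (G_subdiff Tt' Xz)).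
by rewrite expr0n/= mulr_ge0 ?sqr_ge0// add0r.
Qed.

Let mxi j : (0 < j)%N -> measurable_fun setT (xi j : Omega -> borel R d).
Proof.
move=> j0; have jj : [set k | (0 < k <= j)%N] j by rewrite /= j0 leqnn.
exact: (sub_measurable_fun (FF_filtration.1 j) (sub_measurable_generated jj (@FF_xi j))).
Qed.

Section predictable.
Context (i : nat) (vt : Omega -> 'rV[R]_p).
Hypothesis i_range : (0 < i <= n)%N.
Hypothesis vt_FF : sub_measurable (FF i.-1) vt.
Hypothesis vt_Theta : forall w, Theta (vt w).

Let mvt : measurable_fun setT (vt : Omega -> borel R p).
Proof. exact: (sub_measurable_fun (FF_filtration.1 _) vt_FF). Qed.

Lemma cond_law_sample tau : (0 < tau)%N ->
  cond_law_along P (vt : Omega -> borel R p) (xi (i.-1 + tau) : Omega -> borel R d)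
    (kap i.-1 (i.-1 + tau)).
Proof.
move=> tau0; apply: (cond_law_of_cond_distribution (FF_filtration.1 i.-1)) => //.
- by apply: mxi; nat_lia.
- by apply: kap_cond; nat_lia.
Qed.

Lemma gradient_sqr_sample j : (i <= j)%N ->
  mean_le P (fun w => gradient_sqr (vt w, xi j w)) (Gc ^+ 2).
Proof.
move=> ij; have j0 : (0 < j)%N by nat_lia.
apply: mean_le_ge0.
- exact: (measurableT_comp measurable_gradient_sqr (measurable_fun_pair mvt (mxi j0))).
- by move=> w; exact: gradient_sqr_ge0.
have vtj : sub_measurable (FF (minn j n).-1) vt.
  apply: sub_measurable_mono vt_FF; apply: FF_filtration.2; nat_lia.
have := A1 j0 vtj vt_Theta; rewrite unlock; apply: le_trans.
by apply: le_integral_nonmeasurable => w; rewrite lee_fin ?gradient_sqr_ge0//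
  gradient_sqrE//; exact: xi_Xi.
Qed.

(** Mixing at arbitrarily small levels transfers the moment bound from the
    sampled states to the invariant law. *)
Lemma gradient_sqr_stationary :
  (\int[P]_w \int[Pi]_x (gradient_sqr (vt w, x))%:E <= (Gc ^+ 2)%:E)%E.
Proof.
apply: (stationary_le mvt measurable_gradient_sqr gradient_sqr_ge0) => dl dl0.
have mix := mixing_lagP (A3 dl0); set tau := mixing_lag _ _ _ _ in mix.
have tau0 : (0 < tau)%N by case: mix.
exists (xi (i.-1 + tau)), (kap i.-1 (i.-1 + tau)); split.
- exact: cond_law_sample.
- exact: (mixing_set_le i.-1 mix).
- by have [] := gradient_sqr_sample (j := (i.-1 + tau)%N) ltac:(nat_lia).
Qed.

End predictable.

Definition mean_loss t := \int[Pi]_(x in Xi) F t x.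

Lemma loss_gap_integrable t' t : Theta t' -> Theta t ->
  Pi.-integrable setT (fun x => (loss_gap t' (t, x))%:E).
Proof.
move=> Tt' Tt.
have := integrableB mXi (F_int (Theta_NTheta Tt)) (F_int (Theta_NTheta Tt')).
move/(integrable_mkcond _ mXi); congr (_.-integrable _ _); apply/funext => x.
rewrite /loss_gap !patchE.
have [Xx|Xx] := boolP (x \in Xi); last by rewrite memNset// => -[_ /mem_set]; exact/negP.
by rewrite mem_set ?EFinB//; split => //; exact: set_mem.
Qed.

Lemma loss_gap_integral t' t : Theta t' -> Theta t ->
  \int[Pi]_x loss_gap t' (t, x) = mean_loss t - mean_loss t'.
Proof.
move=> Tt' Tt.
rewrite /mean_loss -(RintegralB mXi (F_int (Theta_NTheta Tt)) (F_int (Theta_NTheta Tt'))).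
rewrite [RHS]Rintegral_mkcond; congr (Rintegral _ _ _); apply/funext => x.
rewrite /loss_gap !patchE.
have [Xx|Xx] := boolP (x \in Xi); last by rewrite memNset// => -[_ /mem_set]; exact/negP.
by rewrite mem_set//; split => //; exact: set_mem.
Qed.

Section predictable_gap.
Context (t' : 'rV[R]_p).
Hypothesis Tt' : Theta t'.
Context (i : nat) (vt : Omega -> 'rV[R]_p).
Hypothesis i_range : (0 < i <= n)%N.
Hypothesis vt_FF : sub_measurable (FF i.-1) vt.
Hypothesis vt_Theta : forall w, Theta (vt w).

Let mvt : measurable_fun setT (vt : Omega -> borel R p).
Proof. exact: (sub_measurable_fun (FF_filtration.1 _) vt_FF). Qed.

Let t'_FF : sub_measurable (FF i.-1) (fun=> t').
Proof. exact: sub_measurable_cst (FF_filtration.1 _). Qed.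

Let sqr_bound : R := Rad ^+ 2 * (Gc ^+ 2 + Gc ^+ 2).

Let gap_sample_sqr j : (i <= j)%N ->
  (\int[P]_w (loss_gap t' (vt w, xi j w) ^+ 2)%:E <= sqr_bound%:E)%E.
Proof.
move=> ij.
have [_ +] := mean_leZ (sqr_ge0 Rad) (mean_leD (gradient_sqr_sample i_range vt_FF vt_Theta ij)
   (gradient_sqr_sample i_range t'_FF (fun=> Tt') ij)).
apply: le_trans; apply: le_integral_nonmeasurable => w; rewrite lee_fin ?sqr_ge0//.
exact: (loss_gap_sqr_le (vt w, xi j w) Tt').
Qed.

Let gap_stationary_sqr :
  (\int[P]_w \int[Pi]_x (loss_gap t' (vt w, x) ^+ 2)%:E <= sqr_bound%:E)%E.
Proof.
pose q (u : Omega -> 'rV[R]_p) w := (\int[Pi]_x (gradient_sqr (u w, x))%:E)%E.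
have mq (u : Omega -> 'rV[R]_p) : measurable_fun setT (u : Omega -> borel R p) ->
    measurable_fun setT (q u).
  move=> mu; apply: (measurable_space_average Pi mu (phi := EFin \o gradient_sqr)).
  - by move=> z; exact: gradient_sqr_ge0.
  - by apply/(measurable_EFinP _ gradient_sqr); exact: measurable_gradient_sqr.
have q0 u w : (0 <= q u w)%E.
  by apply: integral_ge0 => x _; rewrite lee_fin gradient_sqr_ge0.
have mt' : measurable_fun setT ((fun=> t') : Omega -> borel R p) by exact: measurable_cst.
apply: (@le_trans _ _ (\int[P]_w ((Rad ^+ 2)%:E * (q vt w + q (fun=> t') w)))%E).
  apply: le_integral_nonmeasurable => w.
    by apply: integral_ge0 => x _; rewrite lee_fin sqr_ge0.
  have mg (s : 'rV[R]_p) : measurable_fun setT (fun x : borel R d => (gradient_sqr (s, x))%:E).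
    by apply/measurable_EFinP/(measurableT_comp measurable_gradient_sqr); exact: pair1_measurable.
  rewrite /q -ge0_integralD//; last 2 first.
  - by move=> x _; rewrite lee_fin gradient_sqr_ge0.
  - by move=> x _; rewrite lee_fin gradient_sqr_ge0.
  rewrite -ge0_integralZl_EFin ?sqr_ge0//; last 2 first.
  - by move=> x _; rewrite -EFinD lee_fin addr_ge0// gradient_sqr_ge0.
  - exact: emeasurable_funD.
  apply: le_integral_nonmeasurable => x; rewrite -?EFinD -?EFinM lee_fin ?sqr_ge0//.
  exact: (loss_gap_sqr_le (vt w, x) Tt').
rewrite ge0_integralZl_EFin ?sqr_ge0//; last 2 first.
- by move=> w _; exact: adde_ge0.
- by apply: emeasurable_funD; exact: mq.
rewrite ge0_integralD//; last 2 first.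
- exact: mq.
- exact: mq.
rewrite -[leRHS]/((Rad ^+ 2)%:E * ((Gc ^+ 2)%:E + (Gc ^+ 2)%:E))%E.
apply: lee_wpmul2l; first by rewrite lee_fin sqr_ge0.
by apply: leeD; [exact: (gradient_sqr_stationary i_range vt_FF vt_Theta)|
  exact: (gradient_sqr_stationary i_range t'_FF (fun=> Tt'))].
Qed.

(** [mixing_gap] with the second moment [2 Rad^2 Gc^2] of the gap. *)
Lemma loss_gap_mixing (eps : R) tau : 0 < eps -> mixing_set P Pi kap eps tau ->
  [/\ P.-integrable setT (fun w => (mean_loss (vt w) - mean_loss t')%:E),
      P.-integrable setT
        (fun w => (F (vt w) (xi (i.-1 + tau) w) - F t' (xi (i.-1 + tau) w))%:E) &
      mean_le P (fun w => (mean_loss (vt w) - mean_loss t') -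
         (F (vt w) (xi (i.-1 + tau) w) - F t' (xi (i.-1 + tau) w)))
        (2 * Num.sqrt 2 * Gc * Rad * eps)].
Proof.
move=> eps0 mix; have tau0 : (0 < tau)%N by case: mix.
have c0 : 0 < sqr_bound.
  by rewrite mulr_gt0 ?exprn_gt0// addr_gt0// exprn_gt0.
have sqrtE : Num.sqrt sqr_bound = Num.sqrt 2 * Gc * Rad.
  rewrite (_ : sqr_bound = 2 * (Gc * Rad) ^+ 2); last by rewrite /sqr_bound; ring.
  by rewrite sqrtrM// sqrtr_sqr ger0_norm ?mulrA// mulr_ge0 ?ltW.
have aE w : \int[Pi]_x loss_gap t' (vt w, x) = mean_loss (vt w) - mean_loss t'.
  exact: loss_gap_integral.
have bE w : loss_gap t' (vt w, xi (i.-1 + tau)%N w) =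
    F (vt w) (xi (i.-1 + tau)%N w) - F t' (xi (i.-1 + tau)%N w).
  by rewrite loss_gapE//; apply: xi_Xi; nat_lia.
have [] := mixing_gap mvt (measurable_loss_gap Tt') eps0 c0
  (cond_law_sample i_range vt_FF tau0) (mixing_set_le i.-1 mix)
  (gap_sample_sqr (j := (i.-1 + tau)%N) ltac:(nat_lia)) gap_stationary_sqr
  (fun w => loss_gap_integrable Tt' (vt_Theta w)).
rewrite (funext (fun w => congr1 EFin (aE w))) (funext (fun w => congr1 EFin (bE w))).
move=> ia ib ab; split => //; split; first exact: integrableB ia ib.
rewrite (integralB_EFin measurableT ia ib).
rewrite leeBlDl; last exact: integrable_fin_num ib.
apply: le_trans ab _; rewrite sqrtE.
by rewrite (_ : 2 * eps * _ = 2 * Num.sqrt 2 * Gc * Rad * eps)//; ring.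
Qed.

Lemma loss_gap_mean :
  mean_le P (fun w => mean_loss (vt w) - mean_loss t') (Gc * Rad).
Proof.
have [ia _ _] := loss_gap_mixing ltr01 (mixing_lagP (A3 ltr01)).
split => //.
pose q w := (\int[Pi]_x (gradient_sqr (vt w, x))%:E)%E.
have mq : measurable_fun setT q.
  apply: (measurable_space_average Pi mvt (phi := EFin \o gradient_sqr)).
  - by move=> z; exact: gradient_sqr_ge0.
  - by apply/(measurable_EFinP _ gradient_sqr); exact: measurable_gradient_sqr.
have q0 w : (0 <= q w)%E.
  by apply: integral_ge0 => x _; rewrite lee_fin gradient_sqr_ge0.
have r0 : 0 <= Rad / 2 by rewrite divr_ge0// ltW.
have g0 : 0 <= Gc^-1 by rewrite invr_ge0 ltW.
have Gc0 : 0 <= Gc by exact: ltW.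
have mgq : measurable_fun setT (fun w => (Gc^-1)%:E * q w + Gc%:E)%E.
  by apply: emeasurable_funD => //; exact: measurable_funeM.
apply: (@le_trans _ _ (\int[P]_w ((Rad / 2)%:E * ((Gc^-1)%:E * q w + Gc%:E)))%E).
  apply: integral_le_ge0 => w; last first.
    by rewrite mule_ge0 ?lee_fin// adde_ge0 ?lee_fin// mule_ge0 ?lee_fin.
  rewrite -(loss_gap_integral Tt' (vt_Theta w)) /Rintegral fineK; last first.
    exact: integrable_fin_num (loss_gap_integrable Tt' (vt_Theta w)).
  have mg : measurable_fun setT (fun x : borel R d => (gradient_sqr (vt w, x))%:E).
    by apply/measurable_EFinP/(measurableT_comp measurable_gradient_sqr); exact: pair1_measurable.
  have -> : ((Rad / 2)%:E * ((Gc^-1)%:E * q w + Gc%:E) =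
      \int[Pi]_x (Rad / 2 * (Gc^-1 * gradient_sqr (vt w, x) + Gc))%:E)%E.
    rewrite -(integral_probability_cst Pi Gc) /q -ge0_integralZl_EFin//; last first.
      by move=> x _; rewrite lee_fin gradient_sqr_ge0.
    rewrite -ge0_integralD//; last 2 first.
    - by move=> x _; rewrite -EFinM lee_fin mulr_ge0 ?gradient_sqr_ge0.
    - exact: measurable_funeM.
    rewrite -ge0_integralZl_EFin//.
    - by move=> x _; rewrite -EFinM -EFinD lee_fin addr_ge0// mulr_ge0 ?gradient_sqr_ge0.
    - by apply: emeasurable_funD => //; exact: measurable_funeM.
  apply: integral_le_ge0 => x; rewrite lee_fin; first exact: loss_gap_le.
  by rewrite mulr_ge0// addr_ge0// mulr_ge0 ?gradient_sqr_ge0.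
rewrite ge0_integralZl_EFin//; last first.
  by move=> w _; rewrite adde_ge0 ?lee_fin// mule_ge0 ?lee_fin.
rewrite ge0_integralD//; last 2 first.
- by move=> w _; rewrite mule_ge0 ?lee_fin.
- exact: measurable_funeM.
rewrite integral_probability_cst ge0_integralZl_EFin//.
apply: (@le_trans _ _ ((Rad / 2)%:E * ((Gc^-1)%:E * (Gc ^+ 2)%:E + Gc%:E))%E).
  apply: lee_wpmul2l; rewrite ?lee_fin//; apply: leeD => //.
  apply: lee_wpmul2l; rewrite ?lee_fin//.
  exact: (gradient_sqr_stationary i_range vt_FF vt_Theta).
rewrite -[leLHS]/((Rad / 2 * (Gc^-1 * Gc ^+ 2 + Gc))%R%:E) lee_fin.
rewrite (_ : Rad / 2 * _ = Gc * Rad)//; field; exact: lt0r_neq0.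
Qed.

End predictable_gap.
End sampled_losses.

(** * Approximate losses and the regret bound *)

Section approximate_losses.
Context {R : realType} {n p : nat}.
Context {dO : measure_display} {Omega : measurableType dO} (P : probability Omega R).
Context (nrm : 'rV[R]_p -> R).
Hypothesis nrm_norm : is_norm nrm.
Context (Theta NTheta : set 'rV[R]_p).
Hypothesis Theta_convex : convex_set Theta.
Hypothesis Theta_NTheta : Theta `<=` NTheta.
Context (Rad : R).
Hypothesis Theta_diam : forall s t, Theta s -> Theta t -> nrm (s - t) <= Rad.
Context (H : nat -> Omega -> 'rV[R]_p -> R) (K : nat -> Omega -> 'rV[R]_p -> 'rV[R]_p).
Hypothesis mK : forall i, (0 < i <= n)%N ->
  measurable_fun (setT `*` NTheta : set (Omega * borel R p))
    (fun z => K i z.1 z.2 : borel R p).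
Hypothesis NTheta_open : open NTheta.
Hypothesis K_subdiff : forall i, (0 < i <= n)%N ->
  {ae P, forall w, forall t, Theta t ->
    subdifferential NTheta (H i w) t (K i w t)}.
Context (FF : nat -> set (set Omega)).
Hypothesis FF_filtration : is_filtration FF.
Context (Kc : R).
Hypothesis A2 : forall i (vt : Omega -> 'rV[R]_p), (0 < i <= n)%N ->
  sub_measurable (FF i.-1) vt -> (forall w, Theta (vt w)) ->
  ('E_P[fun w => (dual_norm nrm (K i w (vt w)) ^+ 2)%R] <= (Kc ^+ 2)%:E)%E.

Lemma subgradient_exceptional_set : exists N : set Omega,
  [/\ measurable N, P N = 0%E & forall w, ~ N w ->
    forall i, (0 < i <= n)%N -> forall t, Theta t ->
      subdifferential NTheta (H i w) t (K i w t)].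
Proof.
have : {ae P, forall w, forall i, (0 < i <= n)%N -> forall t, Theta t ->
    subdifferential NTheta (H i w) t (K i w t)}.
  apply: ae_foralln => i; have [i_n|i_n] := boolP (0 < i <= n)%N.
    by apply: filterS (K_subdiff i_n) => w.
  by apply: aeW => w.
move=> [N [mN N0 sub]]; exists N; split => // w Nw.
by apply: contrapT => bad; apply: Nw; exact: sub.
Qed.

Section predictable.
Context (i : nat) (vt : Omega -> 'rV[R]_p).
Hypothesis i_range : (0 < i <= n)%N.
Hypothesis vt_FF : sub_measurable (FF i.-1) vt.
Hypothesis vt_Theta : forall w, Theta (vt w).

Let mKv (u : Omega -> 'rV[R]_p) : measurable_fun setT (u : Omega -> borel R p) ->
  (forall w, Theta (u w)) ->
  measurable_fun setT ((fun w => K i w (u w)) : Omega -> borel R p).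
Proof.
move=> mu Tu.
have mpair := measurable_fun_pair (@measurable_id _ Omega setT) mu.
have mD : measurable (setT `*` NTheta : set (Omega * borel R p)).
  by apply: measurableX => //; exact: open_borel.
apply: (measurable_comp mD _ (mK i_range) mpair).
by move=> _ [w _ <-]; split => //=; apply: Theta_NTheta.
Qed.

Let mvt : measurable_fun setT (vt : Omega -> borel R p).
Proof. exact: (sub_measurable_fun (FF_filtration.1 _) vt_FF). Qed.

Lemma dual_norm_sqr_mean :
  mean_le P (fun w => dual_norm nrm (K i w (vt w)) ^+ 2) (Kc ^+ 2).
Proof.
apply: mean_le_ge0.
- apply: measurable_funX.
  exact: (measurableT_comp (measurable_dual_norm nrm_norm) (mKv mvt vt_Theta)).
- by move=> w; exact: sqr_ge0.
- by have := A2 i_range vt_FF vt_Theta; rewrite unlock.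
Qed.

(** The losses [H i] have the prescribed subgradients only outside the null set
    [N], so the gap is set to [0] on [N]. *)
Lemma measurable_approx_gap (N : set Omega) (t : 'rV[R]_p) :
  measurable N -> Theta t ->
  (forall w, ~ N w -> forall s, Theta s -> subdifferential NTheta (H i w) s (K i w s)) ->
  measurable_fun setT ((fun w => H i w (vt w) - H i w t) \_ (~` N)).
Proof.
move=> mN Tt sub; have mCN := measurableC mN.
apply: measurable_fun_restrict0 => //.
apply: (@measurable_subgradient_gap _ _ _ _ (~` N) Theta NTheta vt t (H i)
   (K i)) => //.
- exact: measurable_funTS.
move=> c c01; apply: measurable_funTS.
apply: (mKv (u := fun w => c *: (vt w - t) + t)); first exact: measurable_segment.
by move=> w; exact: convex_set_segment.
Qed.

Lemma approx_gap_integrable (N : set Omega) (t : 'rV[R]_p) :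
  measurable N -> Theta t ->
  (forall w, ~ N w -> forall s, Theta s -> subdifferential NTheta (H i w) s (K i w s)) ->
  mean_le P (fun w => dual_norm nrm (K i w t) ^+ 2) (Kc ^+ 2) ->
  P.-integrable setT (EFin \o ((fun w => H i w (vt w) - H i w t) \_ (~` N))).
Proof.
move=> mN Tt sub Kt; have mgap := measurable_approx_gap mN Tt sub.
apply: (integrable_of_sqr (c := Rad ^+ 2 * (Kc ^+ 2 + Kc ^+ 2)) mgap).
apply: mean_le_ge0; [exact: measurable_funX|by move=> w; exact: sqr_ge0|].
have [_ +] := mean_leZ (sqr_ge0 Rad) (mean_leD dual_norm_sqr_mean Kt).
apply: le_trans; apply: le_integral_nonmeasurable => w; rewrite lee_fin ?sqr_ge0//.
rewrite patchE; case: ifPn => [/set_mem Nw|_].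
  exact: (subgradient_gap_sqr nrm_norm Theta_NTheta Theta_diam (vt_Theta w) Tt
    (sub w Nw _ (vt_Theta w)) (sub w Nw _ Tt)).
by rewrite expr0n/= mulr_ge0 ?sqr_ge0// addr_ge0 ?sqr_ge0.
Qed.

End predictable.
End approximate_losses.

Theorem theorem2p1 (R : realType) (n d p : nat)
  (n_gt0 : (0 < n)%N) (d_gt0 : (0 < d)%N) (p_gt0 : (0 < p)%N)
  (dO : measure_display) (Omega : measurableType dO) (P : probability Omega R)
  (Xi : set (borel R d)) (mXi : measurable Xi)
  (Pi : probability (borel R d) R) (PiXi : Pi Xi = 1%E)
  (xi : nat -> Omega -> 'rV[R]_d)
  (xi_Xi : forall i w, (0 < i)%N -> Xi (xi i w))
  (xi_erg : ergodic_process P Xi xi Pi)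
  (nrm : 'rV[R]_p -> R) (nrm_norm : is_norm nrm)
  (Theta NTheta : set 'rV[R]_p)
  (Theta_compact : compact Theta) (Theta_convex : convex_set Theta)
  (NTheta_open : open NTheta) (Theta_NTheta : Theta `<=` NTheta)
  (F : 'rV[R]_p -> 'rV[R]_d -> R)
  (F_convex : forall x, Xi x -> convex_function NTheta (fun t => F t x))
  (F_int : forall t, NTheta t -> Pi.-integrable Xi (fun x => (F t x)%:E))
  (G : 'rV[R]_p -> 'rV[R]_d -> 'rV[R]_p)
  (mG : measurable_fun (Theta `*` Xi : set (borel R p * borel R d))
          (fun z => G z.1 z.2 : borel R p))
  (G_subdiff : forall t x, Theta t -> Xi x ->
     subdifferential NTheta (fun u => F u x) t (G t x))
  (H : nat -> Omega -> 'rV[R]_p -> R)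
  (mH : forall i t, (0 < i <= n)%N -> NTheta t ->
     measurable_fun setT (fun w => H i w t))
  (H_convex : forall i w, (0 < i <= n)%N -> convex_function NTheta (H i w))
  (K : nat -> Omega -> 'rV[R]_p -> 'rV[R]_p)
  (mK : forall i, (0 < i <= n)%N ->
     measurable_fun (setT `*` NTheta : set (Omega * borel R p))
       (fun z => K i z.1 z.2 : borel R p))
  (K_subdiff : forall i, (0 < i <= n)%N ->
     {ae P, forall w, forall t, Theta t ->
        subdifferential NTheta (H i w) t (K i w t)})
  (psi : 'rV[R]_p -> R)
  (psi_diff : forall t, NTheta t -> differentiable (psi : 'rV[R]_p -> R^o) t)
  (psi_convex : strongly_convex_function 1 nrm NTheta psi)
  (Rad : R) (Rad_gt0 : 0 < Rad)
  (Rad_bound : forall t1 t2, Theta t1 -> Theta t2 ->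
     bregman psi t1 t2 <= Rad ^+ 2 / 2)
  (eta : nat -> R) (eta_gt0 : forall i, (0 < i)%N -> 0 < eta i)
  (eta_noninc : forall i j, (0 < i)%N -> (i <= j)%N -> eta j <= eta i)
  (theta : nat -> Omega -> 'rV[R]_p)
  (theta1 : forall w, Theta (theta 1%N w))
  (theta_step : forall i w, (0 < i <= n)%N ->
     is_argmin Theta
       (fun t => inner (K i w (theta i w)) t + (eta i)^-1 * bregman psi t (theta i w))
       (theta i.+1 w))
  (FF : nat -> set (set Omega)) (FF_filtration : is_filtration FF)
  (FF_xi : forall i, sigma_generated [set j | (0 < j <= i)%N] xi `<=` FF i)
  (FF_theta : forall i, (i <= n)%N ->
     sigma_generated [set j | (0 < j <= i.+1)%N] theta `<=` FF i)
  (kap : nat -> nat -> Omega -> probability (borel R d) R)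
  (kap_cond : forall i j, (i < j)%N ->
     is_cond_distribution P (FF i) (xi j) (kap i j))
  (Gc : R) (Gc_gt0 : 0 < Gc)
  (A1 : forall i (vt : Omega -> 'rV[R]_p), (0 < i)%N ->
     sub_measurable (FF (minn i n).-1) vt -> (forall w, Theta (vt w)) ->
     ('E_P[fun w => (dual_norm nrm (G (vt w) (xi i w)) ^+ 2)%R] <= (Gc ^+ 2)%:E)%E)
  (Kc : R) (Kc_gt0 : 0 < Kc)
  (A2 : forall i (vt : Omega -> 'rV[R]_p), (0 < i <= n)%N ->
     sub_measurable (FF i.-1) vt -> (forall w, Theta (vt w)) ->
     ('E_P[fun w => (dual_norm nrm (K i w (vt w)) ^+ 2)%R] <= (Kc ^+ 2)%:E)%E)
  (A3 : forall eps : R, 0 < eps -> (mixing_time P Pi kap eps < +oo)%E)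
  (eps : R) (eps_gt0 : 0 < eps) (theta' : 'rV[R]_p) (theta'_Theta : Theta theta') :
  let f := fun t : 'rV[R]_p => \int[Pi]_(x in Xi) F t x in
  let tau := mixing_lag P Pi kap eps in
  is_true ('E_P[fun w => (\sum_(1 <= i < n.+1) (f (theta i w) - f theta'))%R]
   <= (2 * Num.sqrt 2 * Gc * Rad * n%:R * eps
       + Num.sqrt 2 * (tau%:R - 1) * Kc ^+ 2 * \sum_(1 <= i < n.+1) eta i
       + Rad ^+ 2 / (2 * eta n)
       + Kc ^+ 2 / 2 * \sum_(1 <= i < n.+1) eta i
       + (tau%:R - 1) * Gc * Rad)%:E
      + 'E_P[fun w => (residual F H xi (tau - 1) n theta w
                       - residual F H xi (tau - 1) n (fun _ _ => theta') w)%R])%E.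
Proof.
move=> f tau.
have taumix : mixing_set P Pi kap eps tau by apply: mixing_lagP; exact: A3.
have tau0 : (0 < tau)%N by case: taumix.
clearbody tau.
pose m := (tau - 1)%N.
have tauE : tau%:R - 1 = m%:R :> R by rewrite /m natrB.
rewrite !tauE -/m.
have Theta_closed : closed Theta by apply: compact_closed => //; exact: norm_hausdorff.
have diam s t : Theta s -> Theta t -> nrm (s - t) <= Rad.
  exact: (diameter_le_radius nrm_norm Theta_NTheta psi_diff psi_convex Rad_gt0 Rad_bound).
have thT i w : (0 < i <= n)%N -> Theta (theta i w).
  case: i => [//|[|i]] // iN.
  by have [] := theta_step i.+1 w ltac:(nat_lia).
have th_FF i : (0 < i <= n)%N -> sub_measurable (FF i.-1) (theta i).
  move=> iN; have ii : [set j | (0 < j <= i.-1.+1)%N] i by rewrite /=; nat_lia.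
  by apply: (sub_measurable_generated ii); apply: FF_theta; nat_lia.
have t'_FF i : sub_measurable (FF i) (fun=> theta').
  exact: sub_measurable_cst (FF_filtration.1 _).
have [N [mN N0 Nsub]] := subgradient_exceptional_set K_subdiff.
pose a i w := f (theta i w) - f theta'.
pose b i w := F (theta i w) (xi (i + m)%N w) - F theta' (xi (i + m)%N w).
(* [a], [b] and [h] are the excess of the mean, sampled and approximate losses *)
pose h i : Omega -> R :=
  (fun w => H (i + m)%N w (theta i w) - H (i + m)%N w theta') \_ (~` N).
have thTi i (i_n : (0 < i <= n)%N) w : Theta (theta i w) by exact: thT.
have ab i : (0 < i <= n)%N -> [/\ P.-integrable setT (EFin \o a i),
    P.-integrable setT (EFin \o b i) &
    mean_le P (fun w => a i w - b i w) (2 * Num.sqrt 2 * Gc * Rad * eps)].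
  move=> i_n; rewrite /b (_ : i + m = i.-1 + tau)%N; last by rewrite /m; nat_lia.
  exact: (loss_gap_mixing mXi xi_Xi nrm_norm Theta_closed Theta_convex Theta_NTheta
    Rad_gt0 diam F_int mG G_subdiff FF_filtration FF_xi kap_cond Gc_gt0 A1 A3
    theta'_Theta i_n (th_FF i i_n) (thTi i i_n) eps_gt0 taumix).
have amean i : (0 < i <= n)%N -> mean_le P (a i) (Gc * Rad).
  move=> i_n.
  exact: (loss_gap_mean mXi xi_Xi nrm_norm Theta_closed Theta_convex Theta_NTheta
    Rad_gt0 diam F_int mG G_subdiff FF_filtration FF_xi kap_cond Gc_gt0 A1 A3
    theta'_Theta i_n (th_FF i i_n) (thTi i i_n)).
have th_past i j : (0 < i)%N -> (i <= j <= n)%N -> sub_measurable (FF j.-1) (theta i).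
  move=> i0 ij; apply: (sub_measurable_mono (GG := FF i.-1)); last by apply: th_FF; nat_lia.
  by apply: FF_filtration.2; nat_lia.
have Kmean i j : (0 < i)%N -> (i <= j <= n)%N ->
    mean_le P (fun w => dual_norm nrm (K j w (theta i w)) ^+ 2) (Kc ^+ 2).
  move=> i0 ij; have j_n : (0 < j <= n)%N by nat_lia.
  apply: (dual_norm_sqr_mean nrm_norm Theta_NTheta mK NTheta_open FF_filtration A2 j_n).
    exact: th_past.
  by move=> w; apply: thT; nat_lia.
have hint i : (0 < i)%N -> (i + m <= n)%N -> P.-integrable setT (EFin \o h i).
  move=> i0 im; have im_n : (0 < i + m <= n)%N by nat_lia.
  apply: (approx_gap_integrable nrm_norm Theta_convex Theta_NTheta diam mK NTheta_open
    FF_filtration A2 im_n _ _ mN theta'_Theta) => //.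
  - by apply: th_past; nat_lia.
  - by move=> w; apply: thT; nat_lia.
  - by move=> w Nw; exact: Nsub.
  - exact: (dual_norm_sqr_mean nrm_norm Theta_NTheta mK NTheta_open FF_filtration A2 im_n).
(* number of indices whose delayed state is observed within the horizon *)
pose q := (n - m)%N.
pose dK j i w := dual_norm nrm (K j w (theta i w)).
pose V w := \sum_(1 <= i < q.+1) \sum_(i <= j < i + m)
    eta j / 2 * (dK (i + m)%N i w ^+ 2 + dK j j w ^+ 2)
  + (Rad ^+ 2 / (2 * eta n) + \sum_(1 <= i < n.+1) eta i / 2 * dK i i w ^+ 2).
have eta_half i : (0 < i)%N -> 0 <= eta i / 2.
  by move=> i0; rewrite divr_ge0// ltW// eta_gt0.
have V0 w : 0 <= V w.
  apply: addr_ge0.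
    rewrite big_nat_cond; apply: sumr_ge0 => i /andP[/andP[i0 _] _].
    rewrite big_nat_cond; apply: sumr_ge0 => j /andP[/andP[ij _] _].
    by rewrite mulr_ge0 ?addr_ge0 ?sqr_ge0// eta_half//; nat_lia.
  apply: addr_ge0; first by rewrite divr_ge0 ?sqr_ge0// mulr_ge0// ltW// eta_gt0.
  rewrite big_nat_cond; apply: sumr_ge0 => i /andP[/andP[i0 _] _].
  by rewrite mulr_ge0 ?sqr_ge0// eta_half.
have Vmean : mean_le P V (\sum_(1 <= i < q.+1) \sum_(i <= j < i + m)
    eta j / 2 * (Kc ^+ 2 + Kc ^+ 2)
  + (Rad ^+ 2 / (2 * eta n) + \sum_(1 <= i < n.+1) eta i / 2 * Kc ^+ 2)).
  apply: mean_leD.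
    apply: mean_le_sum => i iq; apply: mean_le_sum => j ij.
    apply: mean_leZ; first by apply: eta_half; nat_lia.
    by apply: mean_leD; apply: Kmean; rewrite /q in iq; nat_lia.
  apply: mean_leD; first exact: mean_le_cst.
  apply: mean_le_sum => i i_n; apply: mean_leZ; first by apply: eta_half; nat_lia.
  by apply: Kmean; nat_lia.
have hV w : \sum_(1 <= i < q.+1) h i w <= V w.
  have [Nw|Nw] := pselect (N w).
    rewrite big1// => i _; rewrite /h patchE memNset//; exact.
  rewrite (eq_bigr (fun i => H (i + m)%N w (theta i w) - H (i + m)%N w theta')); last first.
    by move=> i _; rewrite /h patchE mem_set.
  apply: (delayed_regret_le nrm_norm Theta_convex Theta_NTheta psi_diff psi_convex
    Rad_bound eta_gt0 eta_noninc (k := fun i => K i w)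
    (th := fun i => theta i w) (theta1 w) _ n_gt0
    (h := fun i => H i w) _ m theta'_Theta).
  - by move=> i i_n; exact: theta_step.
  - by move=> i i_n; exact: Nsub.
have hsum : P.-integrable setT (EFin \o (fun w => \sum_(1 <= i < q.+1) h i w)).
  by apply: integrable_sum_nat => i iq; apply: hint; rewrite /q in iq; nat_lia.
have hmean := mean_le_dominated hsum hV V0 Vmean.
pose res w := \sum_(1 <= i < q.+1) (b i w - h i w).
have q_n : (q <= n)%N by exact: leq_subr.
have ires : P.-integrable setT (EFin \o res).
  apply: integrable_sum_nat => i iq; have [_ ib _] := ab i ltac:(nat_lia).
  have ih : P.-integrable setT (EFin \o h i) by apply: hint; rewrite /q in iq; nat_lia.
  exact: integrableB ib ih.
have resE : ('E_P[fun w => (residual F H xi m n theta w -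
    residual F H xi m n (fun _ _ => theta') w)%R] = \int[P]_w (res w)%:E)%E.
  rewrite unlock; apply: ae_eq_integral_nonmeasurable; first exact: measurable_int ires.
  exists N; split => // w /=; apply: contra_notP => Nw.
  rewrite /residual -sumrB; congr _%:E; apply: eq_bigr => i _.
  rewrite /b /h patchE mem_set//; ring.
pose rest w := (\sum_(1 <= i < q.+1) (a i w - b i w) + \sum_(q.+1 <= i < n.+1) a i w)
   + \sum_(1 <= i < q.+1) h i w.
have gapmean : mean_le P (fun w => \sum_(1 <= i < q.+1) (a i w - b i w))
    (\sum_(1 <= i < q.+1) (2 * Num.sqrt 2 * Gc * Rad * eps)).
  by apply: mean_le_sum => i iq; have [] := ab i ltac:(nat_lia).
have tailmean : mean_le P (fun w => \sum_(q.+1 <= i < n.+1) a i w)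
    (\sum_(q.+1 <= i < n.+1) (Gc * Rad)).
  by apply: mean_le_sum => i iq; apply: amean; nat_lia.
have split_sum w : \sum_(1 <= i < n.+1) (f (theta i w) - f theta') = res w + rest w.
  rewrite (big_cat_nat (n := q.+1))//= /rest /res !sumrB /a; ring.
have [irest rest_le] := mean_leD (mean_leD gapmean tailmean) hmean.
rewrite resE unlock.
under eq_integral do rewrite split_sum.
rewrite (integralD_EFin measurableT ires irest) addeC; apply: leeD => //.
apply: le_trans rest_le _; rewrite lee_fin.
rewrite !sumr_const_nat -[_ *+ (q.+1 - 1)]mulr_natl -[_ *+ (n.+1 - q.+1)]mulr_natl.
have s2 : 1 <= Num.sqrt 2 :> R by rewrite -[leLHS]sqrtr1 ler_wsqrtr// ler1n.
set S := \sum_(1 <= i < n.+1) eta i.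
have K0 : 0 <= Kc ^+ 2 by exact: sqr_ge0.
have mK0 : 0 <= m%:R * Kc ^+ 2 by exact: mulr_ge0.
have dbl : \sum_(1 <= i < q.+1) \sum_(i <= j < i + m) eta j / 2 * (Kc ^+ 2 + Kc ^+ 2)
    <= m%:R * Kc ^+ 2 * S.
  have -> : \sum_(1 <= i < q.+1) \sum_(i <= j < i + m) eta j / 2 * (Kc ^+ 2 + Kc ^+ 2)
      = Kc ^+ 2 * \sum_(1 <= i < q.+1) \sum_(i <= j < i + m) eta j.
    rewrite mulr_sumr; apply: eq_bigr => i _; rewrite mulr_sumr.
    by apply: eq_bigr => j _; field.
  rewrite -mulrA mulrCA; apply: (ler_wpM2l K0).
  exact: window_sum_le.
have S0 : 0 <= S.
  by rewrite /S big_nat_cond; apply: sumr_ge0 => i /andP[/andP[i0 _] _]; apply/ltW/eta_gt0.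
have KS : m%:R * Kc ^+ 2 * S <= Num.sqrt 2 * m%:R * Kc ^+ 2 * S.
  rewrite (_ : Num.sqrt 2 * m%:R * Kc ^+ 2 * S = Num.sqrt 2 * (m%:R * Kc ^+ 2 * S)); last by ring.
  by rewrite ler_peMl// mulr_ge0.
have half : \sum_(1 <= i < n.+1) eta i / 2 * Kc ^+ 2 = Kc ^+ 2 / 2 * S.
  by rewrite /S mulr_sumr; apply: eq_bigr => i _; ring.
rewrite half.
have e1 : (q.+1 - 1)%:R * (2 * Num.sqrt 2 * Gc * Rad * eps) <= 2 * Num.sqrt 2 * Gc * Rad * n%:R * eps.
  rewrite (_ : 2 * Num.sqrt 2 * Gc * Rad * n%:R * eps =
    n%:R * (2 * Num.sqrt 2 * Gc * Rad * eps)); last by ring.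
  rewrite ler_wpM2r//; last by rewrite ler_nat subn1.
  by rewrite !mulr_ge0 ?ltW.
have e2 : (n.+1 - q.+1)%:R * (Gc * Rad) <= m%:R * Gc * Rad.
  rewrite -mulrA; apply: ler_wpM2r; first by rewrite mulr_ge0 ?ltW.
  by rewrite ler_nat subSS leq_subLR addnC -leq_subLR.
lra.
Qed.
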